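(* Let $f$ and $c_i$ ($i\in\mathcal{E}\cup\mathcal{I}$) be real polynomials in $x\in\mathbb{R}^n$ defining the problem $f_{\min}=\min f(x)$ s.t. $c_i(x)=0\ (i\in\mathcal{E})$, $c_j(x)\ge0\ (j\in\mathcal{I})$. Suppose $\mathcal{K}_c\neq\emptyset$ and Assumption A holds with polynomials $p_i$, and let $\phi,\psi,f_c,f_k^{pre},f_k'^{pre}$ be as in the context. Then $f_k^{pre}=f_k'^{pre}=f_c$ for all $k$ sufficiently large. Consequently, if $f_{\min}$ is achieved at a critical point (a feasible point lying in $\mathcal{K}_c$), then $f_k^{pre}=f_k'^{pre}=f_{\min}$ for all $k$ sufficiently large.
   Context: $\mathbb{R}[x]_d$: real polynomials of degree $\le d$; $\Sigma[x]$: sums of squares; $\Sigma[x]_d=\Sigma[x]\cap\mathbb{R}[x]_d$. $\mathcal{E},\mathcal{I}$ are disjoint finite index sets; $c_{eq}=(c_i)_{i\in\mathcal{E}}$, $c_{in}=(c_j)_{j\in\mathcal{I}}$. Critical pairs: $\mathcal{K}=\{(x,\lambda)\in\mathbb{R}^n\times\mathbb{R}^{\mathcal{E}\cup\mathcal{I}}: c_i(x)=0\ (i\in\mathcal{E}),\ \lambda_jc_j(x)=0\ (j\in\mathcal{I}),\ \nabla f(x)=\sum_i\lambda_i\nabla c_i(x)\}$; $\mathcal{K}_c=\{u:\exists\lambda,(u,\lambda)\in\mathcal{K}\}$. Assumption A: for each $i\in\mathcal{E}\cup\mathcal{I}$ there is $p_i\in\mathbb{R}[x]$ with $\lambda_i=p_i(x)$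 for all $(x,\lambda)\in\mathcal{K}$. Then $\phi=\big(\nabla f-\sum_ip_i\nabla c_i,\ (p_jc_j)_{j\in\mathcal{I}}\big)$ (the $n$ entries of the vector followed by the $p_jc_j$), $\psi=(p_j)_{j\in\mathcal{I}}$, and $f_c$ is the optimal value of $\min f(x)$ s.t. $c_{eq}(x)=0$, $c_{in}(x)\ge0$, $\phi(x)=0$, $\psi(x)\ge0$ ($+\infty$ if infeasible). Write the tuple $(c_{in},\psi)$ as $(g_1,\dots,g_\ell)$ and for $r\in\{0,1\}^\ell$ let $g^r=g_1^{r_1}\cdots g_\ell^{r_\ell}$. Truncated preordering: $\mathrm{Preord}(c_{in},\psi)_{2k}=\sum_{r\in\{0,1\}^\ell}g^r\Sigma[x]_{2k-\deg(g^r)}$; truncated ideal: $\mathrm{Ideal}(h)_{2k}=\sum_ih_i\mathbb{R}[x]_{2k-\deg h_i}$. For $y=(y_\alpha)_{|\alpha|\le 2k}$, $\langle\sum f_\alpha x^\alpha,y\rangle=\sum f_\alpha y_\alpha$; for $q\in\mathbb{R}[x]_{2k}$, $L_q^{(k)}(y)$ is the symmetric matrix with $\mathrm{vec}(a_1)^TL_q^{(k)}(y)\mathrm{vec}(a_2)=\langle qa_1a_2,y\rangle$ for all $a_1,a_2\in\mathbb{R}[x]_{k-\lceil\deg(q)/2\rceil}$; for a tuple, block diagonal. Define $f_k'^{pre}=\min\langle f,y\rangle$ s.t. $\langle1,y\rangle=1$, $L_{c_{eq}}^{(k)}(y)=0$, $L_\phi^{(k)}(y)=0$, $L_{g^r}^{(k)}(y)\succeq0$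 for all $r\in\{0,1\}^\ell$, $y\in\mathbb{R}^{\mathbb{N}^n_{2k}}$; $f_k^{pre}=\max\gamma$ s.t. $f-\gamma\in\mathrm{Ideal}(c_{eq},\phi)_{2k}+\mathrm{Preord}(c_{in},\psi)_{2k}$. *)

(* Defs.v *)
(* multivariate polynomials from multinomials' mpoly,
   real numbers as an abstract R : realType, extended reals \bar R for
   optimal values (+oo for infeasible minimisation, -oo for empty max). *)
From HB Require Import structures.
From mathcomp Require Import all_boot all_order all_algebra.
From mathcomp Require Import mpoly.
From mathcomp Require Import reals constructive_ereal.

Set Implicit Arguments.
Unset Strict Implicit.
Unset Printing Implicit Defensive.

Import Order.TTheory GRing.Theory Num.Theory.
Local Open Scope ring_scope.

Section POP.
Context (R : realType) (n : nat).

Local Notation poly := {mpoly R[n]}.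

(* v is the infimum of S (v = +oo iff S is empty) *)
Definition is_einf (S : R -> Prop) (v : \bar R) : Prop :=
  (forall s, S s -> (v <= s%:E)%E) /\
  (forall w : \bar R, (forall s, S s -> (w <= s%:E)%E) -> (w <= v)%E).
(* v is the supremum of S (v = -oo iff S is empty) *)
Definition is_esup (S : R -> Prop) (v : \bar R) : Prop :=
  (forall s, S s -> (s%:E <= v)%E) /\
  (forall w : \bar R, (forall s, S s -> (s%:E <= w)%E) -> (v <= w)%E).

(* total degree (the zero polynomial gets 0, but see [in_deg]) *)
Definition pdeg (p : poly) : nat := (msize p).-1.
(* p \in R[x]_d, for an integer d (possibly negative): 0 always belongs *)
Definition in_deg (d : int) (p : poly) : Prop :=
  p = 0 \/ ((pdeg p)%:Z <= d).
Definition sos (p : poly) : Prop :=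
  exists s : seq poly, p = \sum_(q <- s) q ^+ 2.
Definition sos_deg (d : int) (p : poly) : Prop := sos p /\ in_deg d p.

Definition trunc_ideal (h : seq poly) (k : nat) (p : poly) : Prop :=
  exists a : 'I_(size h) -> poly,
    (forall i : 'I_(size h), in_deg ((2 * k)%N%:Z - (pdeg h`_i)%:Z) (a i)) /\
    p = \sum_(i < size h) h`_i * a i.

(* g^r for r in {0,1}^l, encoded by the subset {i | r_i = 1} *)
Definition gpow (g : seq poly) (r : {set 'I_(size g)}) : poly :=
  \prod_(i in r) g`_i.

Definition trunc_preord (g : seq poly) (k : nat) (p : poly) : Prop :=
  exists s : {set 'I_(size g)} -> poly,
    (forall r : {set 'I_(size g)}, sos_deg ((2 * k)%N%:Z - (pdeg (@gpow g r))%:Z) (s r)) /\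
    p = \sum_(r : {set 'I_(size g)}) @gpow g r * s r.

(* a truncated moment vector y in R^{N^n_{2k}} is represented by a function
   on all monomials, of which only the entries of degree <= 2k are used *)
Definition riesz (k : nat) (y : 'X_{1..n} -> R) (p : poly) : R :=
  \sum_(a <- msupp p | (mdeg a <= 2 * k)%N) p@_a * y a.

(* number (+1) of the degree bound k - ceil(deg q / 2) of the multipliers
   a1, a2 in the localizing matrix; 0 means the bound is negative
   (empty matrix) *)
Definition locbound (k : nat) (q : poly) : nat :=
  if (uphalf (pdeg q) <= k)%N then (k - uphalf (pdeg q)).+1 else 0%N.

Definition locmat (k : nat) (q : poly) (y : 'X_{1..n} -> R) :
  'M[R]_(#|{: 'X_{1..n < locbound k q}}|) :=
  \matrix_(i, j) riesz k y
     (q * 'X_[bmnm (enum_val i)] * 'X_[bmnm (enum_val j)]).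

Definition psd (m : nat) (A : 'M[R]_m) : Prop :=
  forall v : 'cV[R]_m, 0 <= (v^T *m A *m v) ord0 ord0.

Context (me mi : nat).
Context (f : poly) (ceq : 'I_me -> poly) (cin : 'I_mi -> poly).

Definition feasible (x : 'I_n -> R) : Prop :=
  (forall i, (ceq i).@[x] = 0) /\ (forall j, 0 <= (cin j).@[x]).

Definition crit_pair (x : 'I_n -> R) (lam_eq : 'I_me -> R)
    (lam_in : 'I_mi -> R) : Prop :=
  (forall i, (ceq i).@[x] = 0) /\
  (forall j, lam_in j * (cin j).@[x] = 0) /\
  (forall l : 'I_n, (f^`M(l)).@[x] =
      \sum_(i < me) lam_eq i * ((ceq i)^`M(l)).@[x] +
      \sum_(j < mi) lam_in j * ((cin j)^`M(l)).@[x]).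

Definition in_Kc (u : 'I_n -> R) : Prop :=
  exists lam_eq lam_in, crit_pair u lam_eq lam_in.

Context (p_eq : 'I_me -> poly) (p_in : 'I_mi -> poly).

Definition assumptionA : Prop :=
  forall x lam_eq lam_in, crit_pair x lam_eq lam_in ->
    (forall i, lam_eq i = (p_eq i).@[x]) /\ (forall j, lam_in j = (p_in j).@[x]).

Definition ceq_s : seq poly := [seq ceq i | i <- enum 'I_me].
Definition cin_s : seq poly := [seq cin j | j <- enum 'I_mi].

Definition phi : seq poly :=
  [seq f^`M(l) - \sum_(i < me) p_eq i * (ceq i)^`M(l)
               - \sum_(j < mi) p_in j * (cin j)^`M(l) | l <- enum 'I_n]
  ++ [seq p_in j * cin j | j <- enum 'I_mi].

Definition psi : seq poly := [seq p_in j | j <- enum 'I_mi].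

Definition gtuple : seq poly := cin_s ++ psi.

Definition feasible_c (x : 'I_n -> R) : Prop :=
  feasible x /\ (forall q, q \in phi -> q.@[x] = 0) /\
  (forall q, q \in psi -> 0 <= q.@[x]).

Definition fc_vals (v : R) : Prop := exists x, feasible_c x /\ v = f.@[x].

Definition sos_vals (k : nat) (gamma : R) : Prop :=
  exists p1 p2, trunc_ideal (ceq_s ++ phi) k p1 /\
                trunc_preord gtuple k p2 /\
                f - gamma%:MP = p1 + p2.

Definition mom_vals (k : nat) (v : R) : Prop :=
  exists y : 'X_{1..n} -> R,
    riesz k y 1 = 1 /\
    (forall h, h \in ceq_s -> locmat k h y = 0) /\
    (forall h, h \in phi -> locmat k h y = 0) /\
    (forall r : {set 'I_(size gtuple)}, psd (locmat k (@gpow gtuple r) y)) /\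
    v = riesz k y f.

End POP.

(* Main.v *)
Require Import Defs.
From HB Require Import structures.
From mathcomp Require Import all_boot all_order all_algebra.
From mathcomp Require Import generic_quotient ring_quotient fraction polyrcf.
From mathcomp Require Import boolp.
From mathcomp Require classical_sets.
From mathcomp Require Import ring lra zify.
From mathcomp Require Import mpoly.
From mathcomp Require Import reals constructive_ereal.
Set Implicit Arguments.
Unset Strict Implicit.
Unset Printing Implicit Defensive.
Import Order.TTheory GRing.Theory Num.Theory.
Local Open Scope ring_scope.

(** Let T be the preordering generated by the constraints of the tightened
    problem and S its real feasible set.  If no element -h^2, with h a product of
    factors f - v for v in f(S), belonged to T, then T would be contained in a
    prime cone, i.e. the constraints would hold at a point x over an ordered
    field K containing R, with f(x) different from every v in f(S).  On the
    critical variety df = sum_i p_i dc_i is killed by all derivations of K over R,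
    so f(x) is algebraic over R; specialising x to a real point with the same
    signs (Artin-Lang, proved by comparing sign tables in the style of Hormander)
    shows that f(x) is a value of f on S, a contradiction.  Hence -h^2 lies in T
    for some h = prod_i (f - v_i).  For gam below all v_i, X - gam is a square
    modulo prod_i (X - v_i)^2, with degrees bounded independently of gam; this
    gives certificates of bounded degree for f - gam.

    If f_min is attained at a critical point u, uniqueness of the multipliers
    makes the active gradients at u independent; a negative multiplier would
    produce a formal curve through u, feasible to high order, along which f
    decreases, contradicting the certificate expressing minimality of u. *)

(** * Ordered residue fields of preorderings *)

(** S need not be compact, so strict positivity of f - gam would give certificates whose degree
    might grow as gam tends to f_c. Here gam enters only through univariate s and u with s^2 = X -
    gam + u Q, where Q is the square of the product of the X - v_i; their degrees depend only on the
    number of factors. Writing u as a difference of two squares leaves one negative term, a square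
    times -h^2, which is already certified. A single degree thus serves every gam < f_c, and the
    supremum follows without attainment. If S is empty, h = 1 and -1 itself is certified, in
    accordance with f_c = +oo. Avoiding all -h^2, and not only -1, keeps every h nonzero in the
    residue field K. K need not be real closed, and no real closure is built: a sign table involves
    finitely many polynomials, so finitely many roots are adjoined until the divisors of these
    satisfy the intermediate value property. *)

Section ConeOrder.
Variables (A : comNzRingType) (P : A -> Prop) (K : fieldType) (alpha : {rmorphism A -> K}).
Hypotheses (PD : forall a b, P a -> P b -> P (a + b))
  (PM : forall a b, P a -> P b -> P (a * b))
  (Ptot : forall a, P a \/ P (- a))
  (alphaP : forall x, exists a b, alpha b != 0 /\ x * alpha b = alpha a)
  (alpha0 : forall a, alpha a = 0 <-> P a /\ P (- a)).

Let sq a : P (a * a).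
Proof. by case: (Ptot a) => h; [apply: PM|rewrite -mulrNN; apply: PM]. Qed.

(** A fraction a/b equals ab/b^2, so square denominators suffice and the sign is carried by the
    numerator alone. *)
Definition cone_nneg (x : K) : Prop :=
  exists c b, [/\ P c, alpha b != 0 & x * alpha b ^+ 2 = alpha c].

Lemma cone_nneg_tot x : cone_nneg x \/ cone_nneg (- x).
Proof.
have [a [b [b0 e]]] := alphaP x.
have [h|h] := Ptot (a * b); [left; exists (a * b)|right; exists (- (a * b))];
  by exists b; split => //; rewrite ?rmorphN ?rmorphM -?e; ring.
Qed.

Lemma cone_nnegD x y : cone_nneg x -> cone_nneg y -> cone_nneg (x + y).
Proof.
move=> [c [b [Pc b0 e]]] [c' [b' [Pc' b'0 e']]].
exists (c * (b' * b') + c' * (b * b)), (b * b'); split.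
- by apply: PD; apply: PM.
- by rewrite rmorphM mulf_neq0.
- by rewrite rmorphD !rmorphM -e -e'; ring.
Qed.

Lemma cone_nnegM x y : cone_nneg x -> cone_nneg y -> cone_nneg (x * y).
Proof.
move=> [c [b [Pc b0 e]]] [c' [b' [Pc' b'0 e']]].
exists (c * c'), (b * b'); split; first exact: PM.
- by rewrite rmorphM mulf_neq0.
- by rewrite !rmorphM -e -e'; ring.
Qed.

Lemma cone_nneg_anti x : cone_nneg x -> cone_nneg (- x) -> x = 0.
Proof.
move=> [c [b [Pc b0 e]]] [c' [b' [Pc' b'0 e']]].
have h : alpha (c * (b' * b')) = 0.
  apply/alpha0; split; first exact: PM.
  have h : alpha (c' * (b * b) + c * (b' * b')) = 0.
    by rewrite rmorphD !rmorphM -e -e'; ring.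
  have [_ h'] := proj1 (alpha0 _) h.
  suff -> : - (c * (b' * b')) = - (c' * (b * b) + c * (b' * b')) + c' * (b * b).
    by apply: PD => //; apply: PM.
  by ring.
have : x * (alpha b * alpha b') ^+ 2 = 0.
  by rewrite -h !rmorphM -e; ring.
by move/eqP; rewrite mulf_eq0 expf_eq0 /= mulf_eq0 (negPf b0) (negPf b'0) !orbF => /eqP.
Qed.

Definition cone_le (x y : K) : bool := `[< cone_nneg (y - x) >].
Definition cone_norm (x : K) : K := if cone_le 0 x then x else - x.

Fact cone_le0_add x y : cone_le 0 x -> cone_le 0 y -> cone_le 0 (x + y).
Proof.
rewrite /cone_le !subr0 => /asboolP h1 /asboolP h2.
by apply/asboolP; exact: cone_nnegD.
Qed.
Fact cone_le0_mul x y : cone_le 0 x -> cone_le 0 y -> cone_le 0 (x * y).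
Proof.
rewrite /cone_le !subr0 => /asboolP h1 /asboolP h2.
by apply/asboolP; exact: cone_nnegM.
Qed.
Fact cone_le0_anti x : cone_le 0 x -> cone_le x 0 -> x = 0.
Proof.
rewrite /cone_le subr0 sub0r => /asboolP h1 /asboolP h2.
exact: cone_nneg_anti.
Qed.
Fact cone_sub_ge0 x y : cone_le 0 (y - x) = cone_le x y.
Proof. by rewrite /cone_le subr0. Qed.
Fact cone_le0_total x : cone_le 0 x || cone_le x 0.
Proof.
rewrite /cone_le subr0 sub0r.
by have [h|h] := cone_nneg_tot x; apply/orP; [left|right]; apply/asboolP.
Qed.
Fact cone_normN x : cone_norm (- x) = cone_norm x.
Proof.
have e0 : cone_le 0 (- x) = cone_le x 0 by rewrite /cone_le subr0 sub0r.
rewrite /cone_norm opprK e0; have := cone_le0_total x.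
case h1: (cone_le 0 x); case h2: (cone_le x 0) => // _.
by rewrite (cone_le0_anti h1 h2) oppr0.
Qed.
Fact cone_ge0_norm x : cone_le 0 x -> cone_norm x = x.
Proof. by rewrite /cone_norm => ->. Qed.

Definition ordered_frac : Type := K.
HB.instance Definition _ := GRing.Field.on ordered_frac.
HB.instance Definition _ := Num.IntegralDomain_isLeReal.Build ordered_frac
  cone_le0_add cone_le0_mul cone_le0_anti cone_sub_ge0 cone_le0_total
  cone_normN cone_ge0_norm (fun _ _ => erefl).


Lemma cone_order : exists (L : realFieldType) (beta : {rmorphism A -> L}),
  (forall a, P a -> 0 <= beta a) /\ (forall a, beta a = 0 -> P (- a)).
Proof.
exists (ordered_frac : realFieldType), (alpha : {rmorphism A -> ordered_frac}).
split=> [a Pa|a /alpha0[]//].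
change (is_true (cone_le 0 (alpha a))); rewrite /cone_le subr0; apply/asboolP.
exists a, 1; rewrite rmorph1 oner_neq0 expr1n mulr1; split=> //.
Qed.
End ConeOrder.

Section PrimeCone.
Local Open Scope quotient_scope.
Variables (A : comNzRingType) (P : A -> Prop).
Hypotheses (PD : forall a b, P a -> P b -> P (a + b))
  (PM : forall a b, P a -> P b -> P (a * b))
  (Ptot : forall a, P a \/ P (- a))
  (PN1 : ~ P (-1))
  (Pprime : forall a b, P (a * b) -> P (- (a * b)) ->
     (P a /\ P (- a)) \/ (P b /\ P (- b))).

Definition cone_supp : {pred A} := fun a => `[< P a /\ P (- a) >].

Let sq a : P (a * a).
Proof. by case: (Ptot a) => h; [apply: PM|rewrite -mulrNN; apply: PM]. Qed.

Lemma cone_supp_ideal : idealr_closed cone_supp.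
Proof.
split.
- apply/asboolP; rewrite oppr0; have h := sq 0; rewrite mulr0 in h.
  by split.
- by apply/asboolP => -[].
- move=> a u v /asboolP[u1 u2] /asboolP[v1 v2]; apply/asboolP; split.
    apply: PD => //; case: (Ptot a) => h; first exact: PM.
    by rewrite -mulrNN; apply: PM.
  rewrite opprD; apply: PD => //; case: (Ptot a) => h.
    by rewrite -mulrN; apply: PM.
  by rewrite -mulNr; apply: PM.
Qed.

HB.instance Definition _ := isIdealr.Build A cone_supp cone_supp_ideal.

Lemma cone_supp_prime : prime_idealr_closed cone_supp.
Proof.
move=> a b /asboolP[h1 h2]; have [h|h] := Pprime h1 h2.
  by apply/orP; left; apply/asboolP.
by apply/orP; right; apply/asboolP.
Qed.

HB.instance Definition _ := isPrimeIdealrClosed.Build A cone_supp cone_supp_prime.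

Definition cone_quot : Type := {ideal_quot cone_supp}.
HB.instance Definition _ := GRing.ComNzRing.on cone_quot.

(** An integral domain has to carry a unit predicate and an inverse; both are chosen classically,
    the inverse being the identity off the units. *)
Definition cq_unit : {pred cone_quot} := fun x => `[< exists y, y * x = 1 >].
Definition cq_inv (x : cone_quot) : cone_quot :=
  if pselect (exists y, y * x = 1) is left h then projT1 (cid h) else x.

Lemma cq_mulV : {in cq_unit, left_inverse 1 cq_inv *%R}.
Proof.
move=> x /asboolP h; rewrite /cq_inv; case: pselect => // h'.
by case: (cid h').
Qed.
Lemma cq_unitP (x y : cone_quot) : y * x = 1 -> cq_unit x.
Proof. by move=> h; apply/asboolP; exists y. Qed.
Lemma cq_inv0 : {in [predC cq_unit], cq_inv =1 id}.
Proof.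
move=> x /negP h; rewrite /cq_inv; case: pselect => // h'.
by case: h; apply/asboolP.
Qed.
HB.instance Definition _ := GRing.ComNzRing_hasMulInverse.Build cone_quot
  cq_mulV cq_unitP cq_inv0.
HB.instance Definition _ := GRing.ComUnitRing_isIntegral.Build cone_quot
  (@Quotient.rquot_IdomainAxiom _ cone_supp).

Definition cone_field : Type := {fraction cone_quot}.
HB.instance Definition _ := GRing.Field.on cone_field.

Definition cone_pi (a : A) : cone_quot := \pi_{ideal_quot cone_supp} a.
Definition cone_proj (a : A) : cone_field := tofrac (cone_pi a).

Lemma cone_projB : zmod_morphism cone_proj.
Proof.
move=> a b; rewrite /cone_proj -[_ + _ in RHS]/(tofrac _ - tofrac _).
rewrite -tofracB; congr tofrac.
exact: (rmorphB (\pi_{ideal_quot cone_supp} : {rmorphism A -> {ideal_quot cone_supp}})).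
Qed.

Lemma cone_projM : monoid_morphism cone_proj.
Proof.
have pi1 : cone_pi 1 = 1.
  exact: (rmorph1 (\pi_{ideal_quot cone_supp} : {rmorphism A -> {ideal_quot cone_supp}})).
have piM a b : cone_pi (a * b) = cone_pi a * cone_pi b.
  exact: (rmorphM (\pi_{ideal_quot cone_supp} : {rmorphism A -> {ideal_quot cone_supp}})).
split => [|a b]; first by rewrite /cone_proj pi1 tofrac1.
by rewrite /cone_proj piM tofracM.
Qed.

HB.instance Definition _ := GRing.isZmodMorphism.Build A cone_field cone_proj cone_projB.
HB.instance Definition _ := GRing.isMonoidMorphism.Build A cone_field cone_proj cone_projM.

Lemma cone_proj_eq0 a : cone_proj a = 0 <-> P a /\ P (- a).
Proof.
have e : (cone_pi a == 0) = (a \in cone_supp).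
  rewrite -[a in RHS]subr0 Quotient.idealrBE /cone_pi.
  by rewrite (rmorph0 (\pi_{ideal_quot cone_supp} : {rmorphism A -> {ideal_quot cone_supp}})).
rewrite /cone_proj; split.
  by move=> /eqP; rewrite tofrac_eq0 e => /asboolP.
by move=> h; apply/eqP; rewrite tofrac_eq0 e; apply/asboolP.
Qed.

Lemma cone_fieldP (x : cone_field) :
  exists a b, cone_proj b != 0 /\ x * cone_proj b = cone_proj a.
Proof.
have piP (z : cone_quot) : exists a, cone_pi a = z.
  by exists (repr (z : {ideal_quot cone_supp})); rewrite /cone_pi reprK.
elim/quotW: x => r.
have [a ea] := piP \n_r; have [b eb] := piP \d_r.
exists a, b; split.
  by rewrite /cone_proj eb tofrac_eq0 denom_ratioP.
rewrite /cone_proj ea eb; unlock FracField.tofrac.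
rewrite -[LHS]FracField.pi_mul; apply/eqP; rewrite FracField.equivf_def.
by rewrite /FracField.mulf !numden_Ratio ?oner_neq0 ?mulr1 ?denom_ratioP //= mulrC.
Qed.

Lemma prime_cone_field : exists (K : realFieldType) (alpha : {rmorphism A -> K}),
  (forall a, P a -> 0 <= alpha a) /\ (forall a, alpha a = 0 -> P (- a)).
Proof. exact: (@cone_order A P cone_field cone_proj PD PM Ptot cone_fieldP cone_proj_eq0). Qed.
End PrimeCone.

Definition preordering (A : comNzRingType) (P : A -> Prop) : Prop :=
  [/\ forall a b, P a -> P b -> P (a + b),
      forall a b, P a -> P b -> P (a * b) & forall a, P (a ^+ 2)].

Section RealPrime.
Import classical_sets.
Variables (A : comNzRingType) (M : A -> Prop).
Hypotheses (M1 : M 1) (MM : forall a b, M a -> M b -> M (a * b)).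

Local Notation avoids P := (forall g, M g -> ~ P (- g ^+ 2)).

Lemma preordering_adjoin (P : A -> Prop) a : preordering P ->
  preordering (fun b => exists s t, [/\ P s, P t & b = s + a * t]).
Proof.
move=> [PD PM Psq]; split.
- move=> _ _ [s [t [Ps Pt ->]]] [s' [t' [Ps' Pt' ->]]].
  exists (s + s'), (t + t'); split; [exact: PD|exact: PD|ring].
- move=> _ _ [s [t [Ps Pt ->]]] [s' [t' [Ps' Pt' ->]]].
  exists (s * s' + a ^+ 2 * (t * t')), (s * t' + t * s'); split; last by ring.
    by apply: PD; [|apply: (PM) => //]; apply: (PM).
  by apply: PD; apply: (PM).
- move=> b; exists (b ^+ 2), 0; split => //; last by rewrite mulr0 addr0.
  by have := Psq 0; rewrite expr0n.
Qed.

(* A preordering maximal among those avoiding all -g^2, g in M, is a prime cone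
   whose support misses M. *)
Lemma real_prime_avoiding (T : A -> Prop) : preordering T -> avoids T ->
  exists (K : realFieldType) (alpha : {rmorphism A -> K}),
    (forall a, T a -> 0 <= alpha a) /\ (forall g, M g -> alpha g != 0).
Proof.
move=> Tp Tav.
pose admissible (P : set A) := [/\ forall a, T a -> P a, preordering P & avoids P].
have [F FG Ftot|P [Pg Pmax]] := @Zorn_bigcup A (fun P => P = set0 \/ admissible P).
  have [F0|] := pselect (forall X, F X -> X = set0).
    left; rewrite predeqE => x; split => // -[X FX].
    by rewrite (F0 _ FX).
  move=> /existsNP[X0 /not_implyP[FX0 X0n]]; right.
  have gd X : F X -> X != set0 -> admissible X.
    by move=> FX /eqP; have [] := FG _ FX.
  have ne (X : set A) x : X x -> X != set0 by move=> Xx; apply/set0P; exists x.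
  have join X Y x y : F X -> F Y -> X x -> Y y -> exists Z, [/\ F Z, Z x & Z y].
    move=> FX FY Xx Yy; have [h|h] := Ftot _ _ FX FY.
      by exists Y; split => //; apply: h.
    by exists X; split => //; apply: h.
  have [gT [_ _ gsq] _] := gd _ FX0 (introN eqP X0n).
  split; first by move=> a Ta; exists X0 => //; apply: gT.
    split.
    - move=> a b [X FX Xa] [Y FY Yb]; have [Z [FZ Za Zb]] := join _ _ _ _ FX FY Xa Yb.
      by exists Z => //; have [_ [h _ _] _] := gd _ FZ (ne _ _ Za); apply: h.
    - move=> a b [X FX Xa] [Y FY Yb]; have [Z [FZ Za Zb]] := join _ _ _ _ FX FY Xa Yb.
      by exists Z => //; have [_ [_ h _] _] := gd _ FZ (ne _ _ Za); apply: h.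
    - by move=> a; exists X0 => //; apply: gsq.
  move=> g Mg [X FX Xg]; have [_ _ h] := gd _ FX (ne _ _ Xg).
  exact: h Xg.
have Tadm : admissible T by split.
have T0 : T 0 by case: Tp => _ _ h; have := h 0; rewrite expr0n.
have {Pg} [TP Pp Pav] : admissible P.
  case: Pg => // P0; case: (Pmax T); last by right.
  rewrite P0; split; first exact: sub0set.
  by move/(_ 0 T0).
have [PD PM Psq] := Pp.
have P0 : P 0 by exact: TP.
have ext a : ~ P a -> exists g s t, [/\ M g, P s, P t & - g ^+ 2 = s + a * t].
  move=> nPa; apply: contrapT => nex.
  pose B b := exists s t, [/\ P s, P t & b = s + a * t].
  have PB : (P `<=` B)%classic by move=> b Pb; exists b, 0; rewrite mulr0 addr0.
  apply: (Pmax B).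
    split => // BP; apply/nPa/BP; exists 0, 1; rewrite add0r mulr1; split => //.
    by have := Psq 1; rewrite expr1n.
  right; split; [by move=> b /TP /PB|exact: preordering_adjoin|].
  by move=> g Mg [s [t [Ps Pt e]]]; apply: nex; exists g, s, t.
have [|||K [alpha [h1 h2]]] := @prime_cone_field A P PD PM.
- move=> a; apply: contrapT => /not_orP[na nna].
  have [g [s [t [Mg Ps Pt e]]]] := ext _ na.
  have [h [u [w [Mh Pu Pw e']]]] := ext _ nna.
  apply: (Pav (g * h)); first exact: MM.
  (* Multiply g^2 + s = - a t by h^2 + u = a w. *)
  suff -> : - (g * h) ^+ 2 = g ^+ 2 * u + h ^+ 2 * s + s * u + a ^+ 2 * (t * w).
    by apply: (PD); [apply: (PD); [apply: (PD)|]|]; apply: (PM) => //; apply: (PM).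
  have -> : (g * h) ^+ 2 = (- g ^+ 2) * (- h ^+ 2) by ring.
  have eg : g ^+ 2 = - (s + a * t) by rewrite -e opprK.
  have eh : h ^+ 2 = - (u + - a * w) by rewrite -e' opprK.
  by rewrite eg eh; ring.
- by move=> h; apply: (Pav 1) => //; rewrite expr1n.
- move=> a b hab hnab; apply: contrapT => /not_orP[na nb].
  (* The sign of [d] is chosen so that [- d] is outside [P]. Multiplying the two relations gives a
     term - c d t w, which lies in [P] because both signs of a b do. *)
  have pick c : ~ (P c /\ P (- c)) -> exists d g s t,
      [/\ d = c \/ d = - c, M g, P s, P t & - g ^+ 2 = s - d * t].
    move=> nc; have [Pc|nPc] := pselect (P c).
      have [|g [s [t [Mg Ps Pt e]]]] := ext (- c) _; first by move=> h; apply: nc.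
      by exists c, g, s, t; split => //; [left|rewrite e mulNr].
    have [g [s [t [Mg Ps Pt e]]]] := ext _ nPc.
    by exists (- c), g, s, t; split => //; [right|rewrite e mulNr opprK].
  have [c [g [s [t [hc Mg Ps Pt e]]]]] := pick _ na.
  have [d [h [u [w [hd Mh Pu Pw e']]]]] := pick _ nb.
  have hcd : P (- (c * d)).
    by case: hc => ->; case: hd => ->; rewrite ?mulNr ?mulrN ?opprK.
  apply: (Pav (g * h)); first exact: MM.
  suff -> : - (g * h) ^+ 2 = g ^+ 2 * u + h ^+ 2 * s + s * u + (- (c * d)) * (t * w).
    by apply: (PD); [apply: (PD); [apply: (PD)|]|]; apply: (PM) => //; apply: (PM).
  have eg : g ^+ 2 = - (s - c * t) by rewrite -e opprK.
  have eh : h ^+ 2 = - (u - d * w) by rewrite -e' opprK.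
  by rewrite exprMn eg eh; ring.
exists K, alpha; split; first by move=> a /TP /h1.
move=> g Mg; apply/eqP => /(congr1 (fun z => z * alpha g)).
rewrite mul0r -rmorphM => /h2; exact: Pav.
Qed.
End RealPrime.

(** * Adjoining real roots to ordered fields *)

(* Artin's argument: reducing the s_i modulo q, the cofactor h has smaller degree
   than q and again changes sign. *)
Lemma sign_change_not_dvd_sum_squares (K : realFieldType) (q h : {poly K}) (a b : K)
    (s : seq (K * {poly K})) :
  q.[a] * q.[b] < 0 -> all (fun e => 0 <= e.1) s ->
  1 + \sum_(e <- s) e.1 *: e.2 ^+ 2 <> q * h.
Proof.
move: {2}(size q) (leqnn (size q)) => n; elim: n q h s => [|n IH] q h s.
  by rewrite leqn0 size_poly_eq0 => /eqP -> ; rewrite !horner0 mul0r ltxx.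
move=> sq qab s0 e.
have q0 : q != 0 by apply: contraTneq qab => ->; rewrite horner0 mul0r ltxx.
pose L := 1 + \sum_(e <- s) e.1 *: (e.2 %% q) ^+ 2.
have Lpos x : 0 < L.[x].
  rewrite /L hornerD hornerC horner_sum ltr_pwDl ?ltr01 //.
  rewrite big_seq; apply: sumr_ge0 => i si.
  by rewrite hornerZ horner_exp mulr_ge0 ?sqr_ge0 //; apply: (allP s0).
have qL : q %| L.
  have -> : L = q * h - \sum_(e <- s) e.1 *: (e.2 ^+ 2 - (e.2 %% q) ^+ 2).
    rewrite -e /L; under [X in _ = _ - X]eq_bigr => i _ do rewrite scalerBr.
    by rewrite sumrB; ring.
  rewrite dvdp_sub ?dvdp_mulr //; apply: (big_ind (fun p => q %| p)).
  - exact: dvdp0.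
  - by move=> x y; apply: dvdp_add.
  move=> i _; rewrite -mul_polyC dvdp_mull // subr_sqr.
  by rewrite dvdp_mulr // {1}(divp_eq i.2 q) addrK dvdp_mull.
pose h' := L %/ q; have eL : L = q * h' by rewrite mulrC divpK.
have L0 : L != 0 by apply: contraTneq (Lpos 0) => ->; rewrite horner0 ltxx.
have h0 : h' != 0 by apply: contraNneq L0 => h0; rewrite eL h0 mulr0.
have sq1 : (1 < size q)%N.
  rewrite ltnNge; apply/negP => /size1_polyC e1; move: qab.
  by rewrite e1 !hornerC -expr2 ltNge sqr_ge0.
have sL : (size L <= (size q).*2 - 3)%N.
  rewrite (leq_trans (size_polyD _ _)) // geq_max size_poly1.
  apply/andP; split; first by lia.
  apply: (big_ind (fun p : {poly K} => (size p <= (size q).*2 - 3)%N)).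
  - by rewrite size_poly0.
  - by move=> x y hx hy; rewrite (leq_trans (size_polyD _ _)) // geq_max hx.
  move=> i _; rewrite (leq_trans (size_scale_leq _ _)) // expr2.
  have hm : (size (i.2 %% q)%R < size q)%N by rewrite ltn_modp.
  rewrite (leq_trans (size_polyMleq _ _)) //; move: hm sq1.
  by move: (size (i.2 %% q)) (size q) => m k; lia.
have sh : (size h' <= n)%N.
  move: sL; rewrite eL size_mul //; move: sq sq1.
  by move: (size q) (size h') => k m; lia.
have := IH h' q [seq (e.1, e.2 %% q) | e <- s] sh; apply.
- have := Lpos a; have := Lpos b; rewrite eL !hornerM => hb ha.
  have : 0 < (q.[a] * q.[b]) * (h'.[a] * h'.[b]).
    by have := mulr_gt0 ha hb; rewrite mulrACA.
  by rewrite nmulr_rgt0.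
- by rewrite all_map; apply: sub_all s0.
by rewrite big_map [RHS]mulrC -eL.
Qed.

Section SumSquaresModulo.
Variables (K : realFieldType) (q : {poly K}).

(** The weights are needed because nonnegative elements of [K] need not be squares; they force the
    residue field to extend the order of [K]. *)
Definition qcone (p : {poly K}) : Prop := exists (s : seq (K * {poly K})) h,
  all (fun e => 0 <= e.1) s /\ p = \sum_(e <- s) e.1 *: e.2 ^+ 2 + q * h.

Lemma qcone_preordering : preordering qcone.
Proof.
split.
- move=> _ _ [s [h [s0 ->]]] [s' [h' [s'0 ->]]].
  exists (s ++ s'), (h + h'); rewrite all_cat s0 s'0; split => //.
  by rewrite big_cat /=; ring.
- move=> _ _ [s [h [s0 ->]]] [s' [h' [s'0 ->]]].
  exists [seq (e.1 * e'.1, e.2 * e'.2) | e <- s, e' <- s'].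
  exists (h * (\sum_(e <- s') e.1 *: e.2 ^+ 2) + h' * (\sum_(e <- s) e.1 *: e.2 ^+ 2)
          + q * h * h').
  split.
    apply/allP => _ /allpairsP[[e e'] /= [/(allP s0) h1 /(allP s'0) h2 ->]].
    exact: mulr_ge0.
  have -> : \sum_(e <- [seq (e.1 * e'.1, e.2 * e'.2) | e <- s, e' <- s']) e.1 *: e.2 ^+ 2 =
      (\sum_(e <- s) e.1 *: e.2 ^+ 2) * (\sum_(e <- s') e.1 *: e.2 ^+ 2).
    rewrite big_allpairs_dep mulr_suml; apply: eq_bigr => e _.
    rewrite mulr_sumr; apply: eq_bigr => e' _ /=.
    by rewrite exprMn -scalerAl -scalerAr scalerA.
  by ring.
- move=> p; exists [:: (1, p)], 0; rewrite big_seq1 /= ler01 scale1r mulr0 addr0.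
  by split.
Qed.
End SumSquaresModulo.

Definition ivt_poly (K : realFieldType) (p : {poly K}) : Prop :=
  forall a b, a < b -> p.[a] * p.[b] < 0 -> exists2 c, a < c < b & root p c.

Definition nneg_morph (K L : realFieldType) (i : {rmorphism K -> L}) : Prop :=
  forall c, 0 <= c -> 0 <= i c.

(** The extension is the residue field of a prime cone containing [qcone q]. Both [q] and [- q] are
    in the cone, so the class of X is a root; the sign change is what keeps -1 out. *)
Lemma ordered_ext_root (K : realFieldType) (q : {poly K}) (a b : K) :
  q.[a] * q.[b] < 0 ->
  exists (L : realFieldType) (i : {rmorphism K -> L}), nneg_morph i /\
    exists t, root (map_poly i q) t.
Proof.
move=> qab.
have [||g ->|K1 [al [h1 _]]] := @real_prime_avoiding _ (fun p => p = 1) _ _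
    (@qcone K q) (qcone_preordering q).
- by [].
- by move=> x y -> ->; rewrite mulr1.
- rewrite expr1n => -[s [h [s0 e]]].
  apply: (@sign_change_not_dvd_sum_squares K q (- h) a b s) => //.
  by rewrite mulrN -[1]opprK e; ring.
exists K1, (al \o polyC : {rmorphism K -> K1}); split.
  move=> c c0 /=; apply: h1; exists [:: (c, 1)], 0.
  by rewrite big_seq1 /= c0 expr1n mulr0 addr0 alg_polyC.
exists (al 'X); rewrite /root; apply/eqP.
have e p : (map_poly (al \o polyC) p).[al 'X] = al p.
  elim/poly_ind: p => [|p c IH]; first by rewrite !rmorph0 horner0.
  by rewrite !rmorphD !rmorphM /= map_polyX map_polyC hornerD hornerM hornerX hornerC IH.
rewrite e; apply/eqP; rewrite eq_le.
have hq c : qcone q (q * c).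
  by exists [::], c; rewrite big_nil add0r.
have := h1 _ (hq (-1)); have := h1 _ (hq 1).
by rewrite mulr1 mulrN1 rmorphN oppr_ge0 => -> ->.
Qed.

(** A root outside the open interval gives a linear factor that does not change sign between a and
    b, so it can be divided out. With no root left in [K], the root adjoined next is certainly
    new. *)
Lemma rootless_factor (K : realFieldType) (p : {poly K}) (a b : K) : a < b ->
  p.[a] * p.[b] < 0 -> (forall c, a < c < b -> ~~ root p c) ->
  exists p0, [/\ p0 %| p, p0.[a] * p0.[b] < 0 & forall c, ~~ root p0 c].
Proof.
move=> ab; move: {2}(size p) (leqnn (size p)) => n; elim: n p => [|n IH] p.
  by rewrite leqn0 size_poly_eq0 => /eqP -> ; rewrite !horner0 mul0r ltxx.
move=> sp pab nr.
have [[r /factor_theorem[p1 e]]|nor] := pselect (exists r, root p r); last first.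
  by exists p; split => // c; apply/negP => h; apply: nor; exists c.
have p0 : p != 0 by apply: contraTneq pab => ->; rewrite horner0 mul0r ltxx.
have p10 : p1 != 0 by apply: contraNneq p0 => h; rewrite e h mul0r.
have [|||p2 [d2 s2 r2]] := IH p1.
- by move: sp; rewrite e size_Mmonic ?monicXsubC // size_XsubC; lia.
- have rab : 0 <= (a - r) * (b - r).
    rewrite leNgt; apply/negP => h.
    have : a < r < b.
      by case: (ltrgtP a r) h; case: (ltrgtP r b) => //; nra.
    by move/nr; rewrite e rootM root_XsubC eqxx orbT.
  move: pab; rewrite e !hornerM !hornerXsubC mulrACA => h.
  by rewrite ltNge; apply/negP => h'; have := mulr_ge0 h' rab; rewrite leNgt h.
- by move=> c /nr; rewrite e rootM negb_or => /andP[].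
by exists p2; split => //; rewrite e dvdp_mulr.
Qed.

(** Every divisor of [P] that violates the intermediate value property leads to an extension in
    which [P] has one more root. The number of roots is below the size of [P], so the process
    stops. *)
Lemma ordered_ext_ivt (K : realFieldType) (P : {poly K}) : P != 0 ->
  exists (L : realFieldType) (i : {rmorphism K -> L}), nneg_morph i /\
    forall p, p %| map_poly i P -> ivt_poly p.
Proof.
move=> P0.
suff H m : forall (K : realFieldType) (P : {poly K}) rs, P != 0 ->
    uniq rs -> all (root P) rs -> (size P <= size rs + m)%N ->
    exists (L : realFieldType) (i : {rmorphism K -> L}), nneg_morph i /\
      forall p, p %| map_poly i P -> ivt_poly p.
  by apply: (H (size P) K P [::]).
elim: m {K P P0} => [|m IH] K P rs P0 urs ars.
  by rewrite addn0 leqNgt max_poly_roots.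
move=> sP.
have [g|] := pselect (forall p, p %| P -> ivt_poly p).
  exists K, (idfun : {rmorphism K -> K}); split => //.
  by move=> p; rewrite map_poly_id //; apply: g.
move=> /existsNP[p /not_implyP[pP]].
move=> /existsNP[a /existsNP[b /not_implyP[ab /not_implyP[pab nr]]]].
have [|p0 [dp sp rp]] := rootless_factor ab pab.
  by move=> c cab; apply/negP => rc; apply: nr; exists c.
have [K1 [i1 [n1 [t rt]]]] := ordered_ext_root sp.
have [||||K2 [i2 [n2 h2]]] := IH K1 (map_poly i1 P) (t :: map i1 rs).
- by rewrite map_poly_eq0.
- rewrite /= map_inj_uniq ?urs ?andbT; last exact: fmorph_inj.
  apply/negP => /mapP[r _ e]; move: rt; rewrite e fmorph_root.
  by rewrite (negPf (rp r)).
- rewrite /= all_map; apply/andP; split.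
    have : map_poly i1 p0 %| map_poly i1 P.
      by rewrite dvdp_map; apply: dvdp_trans pP.
    by move=> h; rewrite -dvdp_XsubCl; apply: dvdp_trans h; rewrite dvdp_XsubCl.
  by apply: sub_all ars => r /=; rewrite fmorph_root.
- by rewrite size_map_poly /= size_map addSnnS.
exists K2, (i2 \o i1 : {rmorphism K -> K2}); split.
  by move=> c c0; apply/n2/n1.
by move=> p2; rewrite map_poly_comp; apply: h2.
Qed.

(** * Sign tables of univariate polynomials *)

Section UnivariateSigns.
Variable K : realFieldType.
Implicit Types (p q : {poly K}) (a b c : K).

Lemma all_roots_seq p : p != 0 -> exists rs : seq K, forall t, root p t -> t \in rs.
Proof.
move: {2}(size p) (leqnn (size p)) => n; elim: n p => [|n IH] p.
  by rewrite leqn0 size_poly_eq0 => ->.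
move=> sp p0; have [[r /factor_theorem[q e]]|nor] := pselect (exists r, root p r); last first.
  by exists [::] => t rt; case: nor; exists t.
have q0 : q != 0 by apply: contraNneq p0 => h; rewrite e h mul0r.
have [|rs h] := IH q _ q0.
  by move: sp; rewrite e size_Mmonic ?monicXsubC // size_XsubC addn2.
exists (r :: rs) => t; rewrite e rootM root_XsubC inE => /orP[/h ->|->] //.
by rewrite orbT.
Qed.

Lemma seq_has_max (T : eqType) (f : T -> K) (s : seq T) :
  s != [::] -> exists2 x, x \in s & forall y, y \in s -> f y <= f x.
Proof.
elim: s => // x s IH _; have [->|/IH[m ms h]] := eqVneq s [::].
  by exists x; rewrite ?mem_head // => y; rewrite inE => /eqP ->.
have [le|lt] := lerP (f m) (f x).
  exists x; first exact: mem_head.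
  by move=> y; rewrite inE => /predU1P[->//|/h]; move/le_trans; apply.
exists m; first by rewrite inE ms orbT.
by move=> y; rewrite inE => /predU1P[->|/h//]; apply: ltW.
Qed.

(** Closure under divisors allows linear factors to be split off without leaving the hypothesis. *)
Definition ivt_dvd p := forall q, q %| p -> ivt_poly q.

Lemma ivt_noroot p a b : ivt_poly p -> a <= b ->
  (forall c, a <= c <= b -> ~~ root p c) -> 0 < p.[a] * p.[b].
Proof.
move=> ip ab nr.
have ha : ~~ root p a by apply: nr; rewrite lexx ab.
have hb : ~~ root p b by apply: nr; rewrite lexx ab.
rewrite lt_neqAle eq_sym mulf_neq0 //= leNgt; apply/negP => h.
have [e|ab'] := eqVneq a b; first by move: h; rewrite e -expr2 ltNge sqr_ge0.
have [|c /andP[c1 c2]] := ip a b _ h; first by rewrite lt_neqAle ab'.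
by apply/negP/nr; rewrite !ltW.
Qed.

(** Extrema need not exist over [K], so the argument is algebraic: between two consecutive roots, a
    divisor of the derivative changes sign. *)
Lemma ivt_rolle p a b : p != 0 -> ivt_dvd p -> ivt_dvd p^`() -> a < b ->
  root p a -> root p b -> exists2 c, a < c < b & root p^`() c.
Proof.
move=> p0 ip idp ab ra rb.
have [rs hrs] := all_roots_seq p0.
pose rs' := [seq x <- rs | (a < x <= b) && root p x].
have [|d d1 dmin] := @seq_has_max _ (fun x => - x) rs'.
  by apply/eqP => e; have := in_nil b; rewrite -e mem_filter ab lexx rb hrs.
move: d1; rewrite mem_filter => /andP[/andP[/andP[ad db] rd] _].
have nor c : a < c < d -> ~~ root p c.
  move=> /andP[ac cd]; apply/negP => rc.
  have : c \in rs' by rewrite mem_filter ac (le_trans (ltW cd) db) rc hrs.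
  by move/dmin; rewrite lerN2 leNgt cd.
suff [c /andP[ac cd] rc] : exists2 c, a < c < d & root p^`() c.
  by exists c => //; rewrite ac (lt_le_trans cd db).
have [m [q + eq]] := multiplicity_XsubC p a; rewrite p0 /= => qa.
have q0 : q != 0 by apply: contraNneq qa => ->; rewrite root0.
have m0 : (0 < m)%N.
  rewrite lt0n; apply: contraNneq qa => m0.
  by move: ra; rewrite eq m0 expr0 mulr1.
have [k [g + eg]] := multiplicity_XsubC q d; rewrite q0 /= => gd.
have k0 : (0 < k)%N.
  rewrite lt0n; apply: contraNneq gd => k0.
  move: rd; rewrite eq rootM eg k0 expr0 mulr1 => /orP[//|].
  rewrite /root horner_exp hornerXsubC expf_eq0 subr_eq0 => /andP[_ /eqP e].
  by rewrite e ltxx in ad.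
have ga : ~~ root g a by apply: contraNN qa; rewrite eg rootM => ->.
have gp : g %| p by rewrite eq eg -mulrA dvdp_mulr.
have gad : 0 < g.[a] * g.[d].
  apply: ivt_noroot => //; [exact: ip|exact: ltW|move=> c /andP[]].
  rewrite le_eqVlt => /predU1P[<-//|ac]; rewrite le_eqVlt => /predU1P[->//|cd].
  apply: contraNN (nor c _); last by rewrite ac.
  by rewrite eq eg !rootM => ->.
(* With p = (X - a)^m (X - d)^k g, this is the cofactor of (X - a)^(m-1) (X - d)^(k-1) in the
   derivative. Its values at a and d are m (a - d) g(a) and k (d - a) g(d), of opposite signs as [g]
   has no root on [a, d]. *)
pose g1 := m%:R *: (('X - d%:P) * g) + k%:R *: (('X - a%:P) * g)
           + ('X - a%:P) * ('X - d%:P) * g^`().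
have e1 : p^`() = ('X - a%:P) ^+ m.-1 * ('X - d%:P) ^+ k.-1 * g1.
  have dX y j : (('X - y%:P : {poly K}) ^+ j.+1)^`() = j.+1%:R * ('X - y%:P) ^+ j.
    by rewrite deriv_exp derivXsubC mul1r mulr_natl.
  rewrite eq eg /g1; case: (m) m0 => // m' _; case: (k) k0 => // k' _.
  rewrite !derivM !dX -!mul_polyC !polyC_natr /= !exprS; ring.
have g1p : g1 %| p^`() by rewrite e1 dvdp_mull.
have g1ad : g1.[a] * g1.[d] < 0.
  have -> : g1.[a] * g1.[d] = - ((m%:R * k%:R) * ((d - a) ^+ 2 * (g.[a] * g.[d]))).
    by rewrite /g1 !(hornerXsubC, hornerD, hornerZ, hornerM); ring.
  rewrite oppr_lt0; apply: mulr_gt0; first by apply: mulr_gt0; rewrite ltr0n.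
  by apply: mulr_gt0 => //; apply: exprn_gt0; rewrite subr_gt0.
have [c cad rc] := idp _ g1p _ _ ad g1ad.
by exists c => //; rewrite e1 rootM rc orbT.
Qed.

(** Rolle makes x the only root on [a, b], and it is simple since the derivative does not vanish
    there; the cofactor of X - x then keeps its sign. *)
Lemma ivt_crossing p a b x : p != 0 -> ivt_dvd p -> ivt_dvd p^`() ->
  a < x < b -> root p x -> (forall c, a < c < b -> ~~ root p^`() c) ->
  p.[a] * p.[b] < 0.
Proof.
move=> p0 ip idp /andP[ax xb] rx nr.
have ab := lt_trans ax xb.
have nx c : a <= c <= b -> c != x -> ~~ root p c.
  move=> /andP[ac cb]; rewrite neq_lt => /orP[] h; apply/negP => rc.
    have [d /andP[d1 d2]] := ivt_rolle p0 ip idp h rc rx.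
    by apply/negP/nr; rewrite (le_lt_trans ac d1) (lt_trans d2 xb).
  have [d /andP[d1 d2]] := ivt_rolle p0 ip idp h rx rc.
  by apply/negP/nr; rewrite (lt_trans ax d1) (lt_le_trans d2 cb).
have /factor_theorem[g e] := rx.
have gx : ~~ root g x.
  have := nr x; rewrite ax xb e derivM derivXsubC mulr1 => /(_ isT).
  by rewrite /root hornerD hornerM hornerXsubC subrr mulr0 add0r.
have : 0 < g.[a] * g.[b].
  apply: ivt_noroot; [by apply: ip; rewrite e dvdp_mulr|exact: ltW|].
  move=> c cab; have [->//|/(nx _ cab)] := eqVneq c x.
  by rewrite e rootM negb_or => /andP[].
rewrite e !hornerM !hornerXsubC mulrACA => h.
by rewrite pmulr_rlt0 // nmulr_rlt0 ?subr_gt0 ?subr_lt0.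
Qed.

End UnivariateSigns.

Section SignTransfer.
Variables (K L : realFieldType) (x : K) (y : L).
Hypothesis e : sgz x = sgz y.
Lemma sgz_lt0E : (x < 0) = (y < 0).
Proof. by rewrite -[LHS]sgz_lt0 -[RHS]sgz_lt0 e. Qed.
Lemma sgz_gt0E : (0 < x) = (0 < y).
Proof. by rewrite -[LHS]sgz_gt0 -[RHS]sgz_gt0 e. Qed.
Lemma sgz_le0E : (x <= 0) = (y <= 0).
Proof. by rewrite -[LHS]sgz_le0 -[RHS]sgz_le0 e. Qed.
Lemma sgz_ge0E : (0 <= x) = (0 <= y).
Proof. by rewrite -[LHS]sgz_ge0 -[RHS]sgz_ge0 e. Qed.
Lemma sgz_eq0E : (x == 0) = (y == 0).
Proof. by rewrite -[LHS]sgz_eq0 -[RHS]sgz_eq0 e. Qed.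
End SignTransfer.

Lemma sgz_mul_gt0 (K : realFieldType) (x y : K) : 0 < x * y -> sgz x = sgz y.
Proof.
move=> h; have x0 : x != 0 by apply: contraTneq h => ->; rewrite mul0r ltxx.
move: h; rewrite -sgz_gt0 sgzM; case: (sgzP x) x0; case: (sgzP y) => //.
all: by move=> * ; rewrite ?mulr0 ?mulr1 ?mulrN1.
Qed.

Lemma sgz_infty (K : realFieldType) (p : {poly K}) : p != 0 ->
  exists M, forall t, M <= t -> sgz p.[t] = sgz (lead_coef p) /\
    sgz p.[- t] = (-1) ^+ (size p).-1 * sgz (lead_coef p).
Proof.
have pos (q : {poly K}) : q != 0 -> exists M, forall t, M <= t -> sgz q.[t] = sgz (lead_coef q).
  rewrite -lead_coef_eq0 neq_lt => /orP[] h.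
    have [|M hM] := @poly_pinfty_gt_lc _ (- q); first by rewrite lead_coefN oppr_gt0.
    exists M => t /hM; rewrite lead_coefN hornerN lerN2 => h'.
    by rewrite !ltr0_sgz // (le_lt_trans h').
  have [M hM] := poly_pinfty_gt_lc h.
  by exists M => t /hM h'; rewrite !gtr0_sgz // (lt_le_trans h).
move=> p0; have [M1 h1] := pos _ p0.
have sX : size (- 'X : {poly K}) = 2 by rewrite size_polyN size_polyX.
have [|M2 h2] := pos (p \Po - 'X).
  by rewrite -lead_coef_eq0 lead_coef_comp ?sX // mulf_eq0 lead_coef_eq0 (negPf p0)
    lead_coefN lead_coefX expf_eq0 oppr_eq0 oner_eq0 andbF.
exists (Num.max M1 M2) => t; rewrite ge_max => /andP[/h1 -> /h2].
rewrite horner_comp hornerN hornerX => ->; split => //.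
by rewrite lead_coef_comp ?sX // lead_coefN lead_coefX sgzM sgzX sgzN1 mulrC.
Qed.

Lemma root_far (K : realFieldType) (p : {poly K}) (M N t : K) : p != 0 ->
  (forall t, M <= t -> sgz p.[t] = sgz (lead_coef p) /\
    sgz p.[- t] = (-1) ^+ (size p).-1 * sgz (lead_coef p)) ->
  M < N -> N <= `|t| -> ~~ root p t.
Proof.
move=> p0 h MN Nt; have {h} [h1 h2] := h _ (le_trans (ltW MN) Nt).
have lc : sgz (lead_coef p) != 0 by rewrite sgz_eq0 lead_coef_eq0.
rewrite /root -sgz_eq0; case: (ger0P t) h1 h2 => [_ -> //|_ _].
by rewrite opprK => ->; rewrite mulf_eq0 signr_eq0.
Qed.

Lemma seq_bound (K : realFieldType) (s : seq K) : exists M, forall x, x \in s -> x < M.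
Proof.
elim: s => [|a s [M h]]; first by exists 0.
exists (Num.max M (a + 1)) => x; rewrite inE => /predU1P[->|/h h'].
  by rewrite lt_max ltrDl ltr01 orbT.
by rewrite lt_max h'.
Qed.

Lemma seq_separate (K : realFieldType) (lo up : seq K) :
  (forall l u, l \in lo -> u \in up -> l < u) ->
  exists s, (forall l, l \in lo -> l < s) /\ (forall u, u \in up -> s < u).
Proof.
move=> h; have [->|lo0] := eqVneq lo [::].
  have [M hM] := seq_bound [seq - x | x <- up].
  exists (- M); split => // u uu; rewrite ltrNl; apply: hM.
  exact: map_f.
have [m ml mmax] := seq_has_max id lo0.
have [->|up0] := eqVneq up [::].
  by exists (m + 1); split => // l /mmax hl; rewrite (le_lt_trans hl) // ltrDl ltr01.
have [v vu vmin] := seq_has_max (fun x => - x) up0.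
have mv := h _ _ ml vu.
exists ((m + v) / 2); split => [l /mmax /= hl|u /vmin hu]; lra.
Qed.

(** * Order-preserving pairings of finite point sets in two ordered fields *)

Section Matching.
Variables (K L : realFieldType).
Implicit Types (z : seq (K * L)) (F : seq ({poly K} * {poly L})).

Definition same_position z (t : K) (s : L) := forall u, u \in z -> sgz (t - u.1) = sgz (s - u.2).

Definition order_iso z := forall u, u \in z -> same_position z u.1 u.2.

Lemma order_iso_lt z u v : order_iso z -> u \in z -> v \in z -> (u.1 < v.1) = (u.2 < v.2).
Proof. by move=> h uz vz; have := h _ uz _ vz => /sgz_lt0E; rewrite !subr_lt0. Qed.

Lemma order_iso_le z u v : order_iso z -> u \in z -> v \in z -> (u.1 <= v.1) = (u.2 <= v.2).
Proof. by move=> h uz vz; have := h _ uz _ vz => /sgz_le0E; rewrite !subr_le0. Qed.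

Lemma same_position_exists z t : order_iso z -> exists s, same_position z t s.
Proof.
move=> hz; have [[u uz <-]|no] := pselect (exists2 u, u \in z & u.1 = t).
  by exists u.2; apply: hz.
have [l u|s [h1 h2]] := @seq_separate L [seq u.2 | u <- z & u.1 < t] [seq u.2 | u <- z & t < u.1].
  move=> /mapP[v + ->] /mapP[w + ->]; rewrite !mem_filter => /andP[vt vz] /andP[tw wz].
  by rewrite -(order_iso_lt hz) // (lt_trans vt).
exists s => u uz; case: (ltrgtP u.1 t) => h.
- rewrite !gtr0_sgz ?subr_gt0 //; apply: h1; apply/mapP; exists u => //.
  by rewrite mem_filter h.
- rewrite !ltr0_sgz ?subr_lt0 //; apply: h2; apply/mapP; exists u => //.
  by rewrite mem_filter h.
- by case: no; exists u.
Qed.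

Lemma order_iso_neighbours z t : (exists2 u, u \in z & u.1 < t) -> (exists2 u, u \in z & t < u.1) ->
  ~ (exists2 u, u \in z & u.1 = t) ->
  exists u v, [/\ u \in z, v \in z, u.1 < t < v.1 &
    forall w, w \in z -> w.1 <= u.1 \/ v.1 <= w.1].
Proof.
move=> [u0 u0z u0t] [v0 v0z v0t] no.
have [|u + umax] := @seq_has_max _ _ fst [seq u <- z | u.1 < t].
  by apply/eqP => h; have := in_nil u0; rewrite -h mem_filter u0t u0z.
have [|v + vmax] := @seq_has_max _ _ (fun w => - w.1) [seq u <- z | t < u.1].
  by apply/eqP => h; have := in_nil v0; rewrite -h mem_filter v0t v0z.
rewrite !mem_filter => /andP[tv vz] /andP[ut uz].
exists u, v; split => //; first by rewrite ut.
move=> w wz; case: (ltrgtP w.1 t) => h.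
- by left; apply: umax; rewrite mem_filter h.
- by right; rewrite -lerN2; apply: vmax; rewrite mem_filter h.
- by case: no; exists w.
Qed.

Definition sgn_agree z (P : {poly K} * {poly L}) :=
  forall u, u \in z -> sgz P.1.[u.1] = sgz P.2.[u.2].

(** Adding a pair of points beyond everything on either side puts each relevant point between two
    listed ones, so unbounded intervals need no separate treatment. The signs of [P] there agree
    because they depend only on the leading coefficient and the parity of the degree. *)
Lemma matching_bounds z (P : {poly K} * {poly L}) t0 s0 : order_iso z -> P.1 != 0 -> P.2 != 0 ->
  size P.1 = size P.2 -> sgz (lead_coef P.1) = sgz (lead_coef P.2) ->
  sgn_agree z P ->
  exists z2, [/\ [/\ {subset z <= z2}, order_iso z2 & sgn_agree z2 P],
    same_position z t0 s0 -> same_position z2 t0 s0,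
    forall t s, root P.1 t -> root P.2 s -> same_position z t s -> same_position z2 t s &
    exists u v, [/\ u \in z2, v \in z2, u.1 < t0 < v.1 & u.2 < s0 < v.2]].
Proof.
move=> hz P10 P20 sP lP aP.
have [M1 h1] := sgz_infty P10; have [M2 h2] := sgz_infty P20.
have [N1 k1] := seq_bound (M1 :: t0 :: - t0 :: 0 :: [seq u.1 | u <- z] ++ [seq - u.1 | u <- z]).
have [N2 k2] := seq_bound (M2 :: s0 :: - s0 :: 0 :: [seq u.2 | u <- z] ++ [seq - u.2 | u <- z]).
have NM1 : M1 < N1 by apply: k1; rewrite !inE eqxx.
have Nt1 : t0 < N1 by apply: k1; rewrite !inE eqxx !orbT.
have Ntn1 : - N1 < t0 by rewrite ltrNl; apply: k1; rewrite !inE eqxx !orbT.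
have Np1 : 0 < N1 by apply: k1; rewrite !inE eqxx !orbT.
have NM2 : M2 < N2 by apply: k2; rewrite !inE eqxx.
have Nt2 : s0 < N2 by apply: k2; rewrite !inE eqxx !orbT.
have Ntn2 : - N2 < s0 by rewrite ltrNl; apply: k2; rewrite !inE eqxx !orbT.
have Np2 : 0 < N2 by apply: k2; rewrite !inE eqxx !orbT.
have zu1 u : u \in z -> - N1 < u.1 < N1.
  move=> uz; rewrite ltrNl !k1 // !inE mem_cat.
    by rewrite (map_f (fun u => - u.1) uz) !orbT.
  by rewrite (map_f fst uz) !orbT.
have zu2 u : u \in z -> - N2 < u.2 < N2.
  move=> uz; rewrite ltrNl !k2 // !inE mem_cat.
    by rewrite (map_f (fun u => - u.2) uz) !orbT.
  by rewrite (map_f snd uz) !orbT.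
have pz (t : K) (s : L) : - N1 < t < N1 -> - N2 < s < N2 -> same_position z t s ->
    same_position ((N1, N2) :: (- N1, - N2) :: z) t s.
  move=> /andP[a1 a2] /andP[b1 b2] h u; rewrite !inE => /predU1P[->|/predU1P[->|/h//]] /=.
    by rewrite !ltr0_sgz // subr_lt0.
  by rewrite !gtr0_sgz // subr_gt0.
exists ((N1, N2) :: (- N1, - N2) :: z); split; first split.
- by move=> u uz; rewrite !inE uz !orbT.
- move=> u; rewrite !inE => /predU1P[->|/predU1P[->|uz]] /=.
  + move=> v; rewrite !inE => /predU1P[->|/predU1P[->|vz]] /=.
    * by rewrite !subrr !sgz0.
    * by rewrite !gtr0_sgz // subr_gt0 ?gtrN.
    * have /andP[_ a] := zu1 _ vz; have /andP[_ b] := zu2 _ vz.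
      by rewrite !gtr0_sgz // subr_gt0.
  + move=> v; rewrite !inE => /predU1P[->|/predU1P[->|vz]] /=.
    * by rewrite !ltr0_sgz // subr_lt0 ?gtrN.
    * by rewrite !subrr !sgz0.
    * have /andP[a _] := zu1 _ vz; have /andP[b _] := zu2 _ vz.
      by rewrite !ltr0_sgz // subr_lt0.
  + by apply: pz; [exact: zu1|exact: zu2|exact: hz].
- move=> u; rewrite !inE => /predU1P[->|/predU1P[->|/aP//]] /=.
    by rewrite (proj1 (h1 _ (ltW NM1))) (proj1 (h2 _ (ltW NM2))).
  by rewrite (proj2 (h1 _ (ltW NM1))) (proj2 (h2 _ (ltW NM2))) sP lP.
- by apply: pz; apply/andP; split.
- move=> t s rt rs; apply: pz; rewrite -ltr_norml real_ltNge ?num_real //; apply/negP => h.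
    by have := root_far P10 h1 NM1 h; rewrite rt.
  by have := root_far P20 h2 NM2 h; rewrite rs.
- exists (- N1, - N2), (N1, N2); rewrite !inE !eqxx !orbT /=.
  by rewrite Nt1 Ntn1 Nt2 Ntn2.
Qed.
End Matching.

Section MatchingRoot.
Variables (K L : realFieldType) (z : seq (K * L)) (P : {poly K} * {poly L}).
Hypotheses (hz : order_iso z) (P10 : P.1 != 0) (P20 : P.2 != 0)
  (sP : size P.1 = size P.2) (lP : sgz (lead_coef P.1) = sgz (lead_coef P.2))
  (i1 : ivt_dvd P.1) (i1' : ivt_dvd P.1^`()) (i2 : ivt_dvd P.2)
  (d1 : forall t, root P.1^`() t -> exists2 u, u \in z & u.1 = t)
  (aP : sgn_agree z P).

(** A root not in the list lies between two neighbours, where the derivative does not vanish; hence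
    [P.1] has opposite signs at these neighbours, so has [P.2] at their partners, and the
    intermediate value property yields [y]. *)
Lemma matching_root x : root P.1 x -> exists2 y, root P.2 y & same_position z x y.
Proof.
move=> rx; have [[u uz e]|no] := pselect (exists2 u, u \in z & u.1 = x).
  exists u.2; last by rewrite -e; apply: hz.
  by rewrite /root -(sgz_eq0E (aP uz)) e.
have [z2 [[zz2 hz2 aP2] _ _ [u0 [v0 [u0z v0z /andP[h1 h2] _]]]]] := matching_bounds x 0 hz P10 P20 sP lP aP.
have [[w wz2 e]|no2] := pselect (exists2 u, u \in z2 & u.1 = x).
  exists w.2; first by rewrite /root -(sgz_eq0E (aP2 _ wz2)) e.
  by rewrite -e => v /zz2; apply: hz2.
have [|||u [v [uz vz /andP[ux xv] nb]]] := @order_iso_neighbours _ _ z2 x.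
- by exists u0.
- by exists v0.
- by [].
have cr : P.1.[u.1] * P.1.[v.1] < 0.
  apply: (ivt_crossing (x := x)) => //; first by rewrite ux.
  move=> c /andP[uc cv]; apply/negP => /d1[w /zz2 /nb + ew]; rewrite ew.
  by case; [rewrite leNgt uc|rewrite leNgt cv].
have [||y /andP[uy yv] ry] := i2 (dvdpp _) (a := u.2) (b := v.2).
- by rewrite -(order_iso_lt hz2) // (lt_trans ux).
- by rewrite -sgz_lt0 sgzM -aP2 // -aP2 // -sgzM sgz_lt0.
exists y => // w /zz2 wz; have [h|h] := nb w wz.
  have w1 : w.1 < x by exact: le_lt_trans ux.
  have w2 : w.2 < y by apply: le_lt_trans uy; rewrite -(order_iso_le hz2).
  by rewrite !gtr0_sgz ?subr_gt0.
have w1 : x < w.1 by exact: lt_le_trans h.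
have w2 : y < w.2 by apply: (lt_le_trans yv); rewrite -(order_iso_le hz2).
by rewrite !ltr0_sgz ?subr_lt0.
Qed.

Lemma matching_root_inj x x' : root P.1 x -> root P.1 x' ->
  (forall u, u \in z -> sgz (x - u.1) = sgz (x' - u.1)) -> x = x'.
Proof.
wlog lt : x x' / x < x'.
  move=> W rx rx' h; case: (ltrgtP x x') => // lt; first exact: W.
  by apply/esym/W => // u /h.
move=> rx rx' h; have [c /andP[xc cx'] /d1[u /h + e]] := ivt_rolle P10 i1 i1' lt rx rx'.
by rewrite e ltr0_sgz ?subr_lt0 // gtr0_sgz ?subr_gt0.
Qed.
End MatchingRoot.

Section MatchingStep.
Variables (K L : realFieldType).
Implicit Types (z : seq (K * L)) (F G : seq ({poly K} * {poly L})) (P Q : {poly K} * {poly L}).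

(** The list pairs all roots on the two sides in increasing order; the last clause says that both
    families have the same sign table. *)
Definition matching F z :=
 [/\ order_iso z,
  forall u, u \in z -> exists2 P, P \in F & root P.1 u.1 && root P.2 u.2,
  forall P t, P \in F -> root P.1 t -> exists2 u, u \in z & u.1 = t,
  forall P s, P \in F -> root P.2 s -> exists2 u, u \in z & u.2 = s &
  forall t s, same_position z t s -> forall P, P \in F -> sgz P.1.[t] = sgz P.2.[s]].

Definition sign_compatible P := [/\ P.1 != 0, P.2 != 0, size P.1 = size P.2,
   sgz (lead_coef P.1) = sgz (lead_coef P.2) & ivt_dvd P.1 /\ ivt_dvd P.2].

(* Signs on the smaller family are constant between its own roots, so the
   superfluous points can be dropped. *)
Lemma matching_sub F G z : {subset G <= F} -> (forall P, P \in F -> sign_compatible P) ->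
  matching F z -> exists2 z', {subset z' <= z} & matching G z'.
Proof.
move=> GF nF [m1 m2 m3 m4 m5].
pose z' := [seq u <- z | has (fun P => root P.1 u.1) G].
have z'z : {subset z' <= z} by move=> u; rewrite mem_filter => /andP[].
have r12 u P : u \in z -> P \in F -> root P.1 u.1 = root P.2 u.2.
  by move=> uz PF; apply: sgz_eq0E; apply: m5 => //; apply: m1.
exists z' => //; split.
- by move=> u /z'z uz v /z'z vz; apply: m1.
- move=> u; rewrite mem_filter => /andP[/hasP[P PG r1] uz].
  by exists P => //; rewrite r1 -(r12 _ _ uz (GF _ PG)).
- move=> P t PG rt; have [u uz e] := m3 P t (GF _ PG) rt; exists u => //.
  by rewrite mem_filter uz andbT; apply/hasP; exists P => //; rewrite e.
- move=> P s PG rs; have [u uz e] := m4 P s (GF _ PG) rs; exists u => //.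
  rewrite mem_filter uz andbT; apply/hasP; exists P => //.
  by rewrite (r12 _ _ uz (GF _ PG)) e.
move=> t s ts P PG; have PF := GF _ PG.
(* [s] is placed like [t] only relative to the smaller list, [s'] relative to the full one. No root
   of [P.2] separates the two, so its sign is the same at both. *)
have [s' ts'] := same_position_exists t m1.
rewrite (m5 _ _ ts' _ PF).
have [_ _ _ _ [_ i2]] := nF _ PF; have {}i2 := i2 _ (dvdpp _).
have sep c : root P.2 c -> sgz (s' - c) = sgz (s - c).
  move=> rc; have [u uz e] := m4 _ _ PF rc; rewrite -e -(ts' _ uz); apply: ts.
  by rewrite mem_filter uz andbT; apply/hasP; exists P => //; rewrite (r12 _ _ uz PF) e.
case: (eqVneq P.2.[s'] 0) => [r0|n0].
  have := sep s' (introT eqP r0); rewrite subrr sgz0 => /esym/eqP.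
  by rewrite sgz_eq0 subr_eq0 => /eqP ->.
case: (eqVneq P.2.[s] 0) => [r0|n0'].
  have := sep s (introT eqP r0); rewrite subrr sgz0 => /eqP.
  by rewrite sgz_eq0 subr_eq0 => /eqP ->.
case: (leP s' s) => h.
  apply: sgz_mul_gt0; apply: ivt_noroot => // c /andP[h1 h2]; apply/negP => rc.
  have := sep c rc; have h3 : s' != c by apply: contraNneq n0 => ->.
  have h4 : s != c by apply: contraNneq n0' => ->.
  by rewrite ltr0_sgz ?subr_lt0 ?lt_neqAle ?h3 // gtr0_sgz // subr_gt0 lt_neqAle eq_sym h4.
apply/esym/sgz_mul_gt0; apply: ivt_noroot => //; first exact: ltW.
move=> c /andP[h1 h2]; apply/negP => rc.
have := sep c rc; have h3 : s' != c by apply: contraNneq n0 => ->.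
have h4 : s != c by apply: contraNneq n0' => ->.
by rewrite [sgz (s - c)]ltr0_sgz ?subr_lt0 ?lt_neqAle ?h4 // gtr0_sgz // subr_gt0 lt_neqAle eq_sym h3.
Qed.
End MatchingStep.

Definition swapz (K L : realFieldType) (z : seq (K * L)) := [seq (u.2, u.1) | u <- z].

Section MatchingCons.
Variables (K L : realFieldType) (F : seq ({poly K} * {poly L})) (P : {poly K} * {poly L}).

Lemma mem_swapz z (u : L * K) : (u \in swapz z) = ((u.2, u.1) \in (z : seq (K * L))).
Proof.
apply/mapP/idP => [[v vz ->]|h]; first by rewrite -surjective_pairing.
by exists (u.2, u.1) => //; rewrite -surjective_pairing.
Qed.

(** The roots of the derivative are already listed, so [P] has at most one root between neighbouring
    points, and whether there is one is read off from the signs at these points. *)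
Lemma matching_cons z : sign_compatible P -> ivt_dvd P.1^`() -> ivt_dvd P.2^`() ->
  (P.1^`(), P.2^`()) \in F -> sgn_agree z P -> matching F z ->
  exists z', matching (P :: F) z'.
Proof.
move=> [P10 P20 sP lP [i1 i2]] j1 j2 dF aP [m1 m2 m3 m4 m5].
have d1 t : root P.1^`() t -> exists2 u, u \in z & u.1 = t by apply: m3 dF.
have d2 s : root P.2^`() s -> exists2 u, u \in z & u.2 = s by apply: m4 dF.
(* The hypotheses are symmetric in the two fields; exchanging them gives the correspondence of roots
   in the other direction. *)
pose z1 := swapz z; pose P1 := (P.2, P.1).
have hz1 : order_iso z1.
  by move=> u; rewrite mem_swapz => uz v; rewrite mem_swapz => vz; rewrite -(m1 _ uz _ vz).
have d21 s : root P1.1^`() s -> exists2 u, u \in z1 & u.1 = s.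
  by move=> /d2[u uz e]; exists (u.2, u.1) => //; rewrite mem_swapz -surjective_pairing.
have aP1 : sgn_agree z1 P1 by move=> u; rewrite mem_swapz => /aP ->.
have E1 := matching_root m1 P10 P20 sP lP i1 j1 i2 d1 aP.
have E2 y : root P.2 y -> exists2 x, root P.1 x & same_position z x y.
  have := @matching_root _ _ z1 P1 hz1 P20 P10 (esym sP) (esym lP) i2 j2 i1 d21 aP1 y.
  move=> h /h[x rx px]; exists x => // u uz; apply/esym.
  by apply: (px (u.2, u.1)); rewrite mem_swapz -surjective_pairing.
have U1 := @matching_root_inj _ _ z P P10 i1 j1 d1.
have U2 y y' : root P.2 y -> root P.2 y' ->
    (forall u, u \in z -> sgz (y - u.2) = sgz (y' - u.2)) -> y = y'.
  move=> r1 r2 h; apply: (@matching_root_inj _ _ z1 P1 P20 i2 j2 d21) => // u.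
  by rewrite mem_swapz => /h.
have [rs hrs] := all_roots_seq P10.
have /choice[e he] : forall x, exists y, root P.1 x -> root P.2 y /\ same_position z x y.
  move=> x.
  have [/E1[y r p]|nrx] := boolP (root P.1 x); first by exists y.
  by exists 0.
pose w := [seq (x, e x) | x <- rs & root P.1 x].
have wP u : u \in w -> [/\ root P.1 u.1, u.2 = e u.1 & same_position z u.1 u.2].
  by move=> /mapP[x]; rewrite mem_filter => /andP[rx _] -> /=; have [] := he _ rx.
have wI x : root P.1 x -> (x, e x) \in w.
  by move=> rx; apply/mapP; exists x => //; rewrite mem_filter rx hrs.
have zz' : {subset z <= z ++ w} by move=> u uz; rewrite mem_cat uz.
(* Two distinct roots of [P.1] are told apart by some point of [z], which transports their order to
   the partners. *)
have inc u v : u \in w -> v \in w -> u.1 < v.1 -> u.2 < v.2.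
  move=> /wP[ru eu pu] /wP[rv ev pv] lt.
  have [[a az ne]|no] := pselect (exists2 a, a \in z & sgz (u.1 - a.1) <> sgz (v.1 - a.1)); last first.
    suff e1 : u.1 = v.1 by rewrite e1 ltxx in lt.
    by apply: U1 => // a az; apply: contrapT => ne; apply: no; exists a.
  have := pu _ az; have := pv _ az => {pu pv}.
  case: (ltrgtP u.1 a.1) => h hv hu.
  - have hu2 : u.2 < a.2 by move: (sgz_lt0E hu); rewrite !subr_lt0 h => <-.
    apply: (lt_le_trans hu2); rewrite -subr_ge0 -(sgz_ge0E hv) subr_ge0 leNgt.
    apply/negP => h'; apply: ne; by rewrite !ltr0_sgz ?subr_lt0.
  - by case: ne; rewrite !gtr0_sgz ?subr_gt0 // (lt_trans h).
  - have -> : u.2 = a.2.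
      by move/eqP: hu; rewrite h subrr sgz0 eq_sym sgz_eq0 subr_eq0 => /eqP.
    by rewrite -subr_gt0 -(sgz_gt0E hv) subr_gt0 -h.
have R2 y : root P.2 y -> exists x, [/\ root P.1 x, e x = y & same_position z x y].
  move=> r; have [x rx px] := E2 _ r; exists x; split => //.
  have [re pe] := he _ rx; apply: U2 => // u uz.
  by rewrite -(pe _ uz) (px _ uz).
exists (z ++ w); split.
- move=> u; rewrite mem_cat => /orP[uz|uw] v; rewrite mem_cat => /orP[vz|vw].
  + exact: m1.
  + have [_ _ pv] := wP _ vw; have := pv _ uz.
    by rewrite -[u.1 - _]opprB -[u.2 - _]opprB !sgzN => ->.
  + by have [_ _ pu] := wP _ uw; apply: pu.
  + case: (ltrgtP u.1 v.1) => h.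
    * by rewrite !ltr0_sgz ?subr_lt0 //; apply: inc.
    * by rewrite !gtr0_sgz ?subr_gt0 //; apply: inc.
    * have [_ -> _] := wP _ uw; have [_ -> _] := wP _ vw.
      by rewrite h !subrr !sgz0.
- move=> u; rewrite mem_cat => /orP[/m2[Q QF rQ]|/wP[ru eu _]].
    by exists Q => //; rewrite inE QF orbT.
  exists P; first exact: mem_head.
  by rewrite ru eu; have [-> _] := he _ ru.
- move=> Q t; rewrite inE => /predU1P[->|QF] rt; last first.
    by have [u uz eu] := m3 _ _ QF rt; exists u => //; apply: zz'.
  by exists (t, e t) => //; rewrite mem_cat wI ?orbT.
- move=> Q s; rewrite inE => /predU1P[->|QF] rt; last first.
    by have [u uz eu] := m4 _ _ QF rt; exists u => //; apply: zz'.
  have [x [rx ex _]] := R2 _ rt; exists (x, e x) => //.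
  by rewrite mem_cat wI ?orbT.
move=> t s ts Q; rewrite inE => /predU1P[->|QF]; last first.
  by apply: m5 => // u /zz'; apply: ts.
have ts0 : same_position z t s by move=> u /zz'; apply: ts.
have rts : root P.1 t = root P.2 s.
  apply/idP/idP => r.
    have := ts (t, e t); rewrite mem_cat wI ?orbT // subrr sgz0 => /(_ isT)/esym/eqP.
    by rewrite sgz_eq0 subr_eq0 => /eqP ->; have [] := he _ r.
  have [x [rx es _]] := R2 _ r.
  have := ts (x, e x); rewrite mem_cat wI ?orbT //= es subrr sgz0 => /(_ isT)/eqP.
  by rewrite sgz_eq0 subr_eq0 => /eqP ->.
case: (boolP (root P.1 t)) => [r|nr].
  by move: r (r); rewrite {1}rts => /eqP -> /eqP ->; rewrite !sgz0.
have nr2 : ~~ root P.2 s by rewrite -rts.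
have [z2 [[zz2 hz2 aP2] pts prt [u0 [v0 [u0z v0z /andP[h1 h2] _]]]]] :=
  matching_bounds t s m1 P10 P20 sP lP aP.
have {}pts := pts ts0.
have [[u uz eu]|no] := pselect (exists2 u, u \in z2 & u.1 = t).
  have : sgz (t - u.1) = sgz (s - u.2) by apply: pts.
  rewrite eu subrr sgz0 => /esym/eqP; rewrite sgz_eq0 subr_eq0 => /eqP ->.
  by rewrite -eu; apply: aP2.
have [|||u [v [uz vz /andP[ut tv] nb]]] := @order_iso_neighbours _ _ z2 t.
- by exists u0.
- by exists v0.
- by [].
have us : u.2 < s by rewrite -subr_gt0 -(sgz_gt0E (pts _ uz)) subr_gt0.
have sv : s < v.2 by rewrite -subr_lt0 -(sgz_lt0E (pts _ vz)) subr_lt0.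
have ordx x y : root P.1 x -> e x = y -> sgz (t - x) = sgz (s - y).
  by move=> rx <-; apply: (ts (x, e x)); rewrite mem_cat wI ?orbT.
(* Without a root between the left neighbour and t, the sign at t is that of the left neighbour.
   With one, Rolle excludes a second root up to the right neighbour, and the sign is taken from
   there. *)
have [[c /andP[uc ct] rc]|noc] := pselect (exists2 c, u.1 <= c <= t & root P.1 c); last first.
  have k1 : 0 < P.1.[u.1] * P.1.[t].
    apply: ivt_noroot; [exact: i1|exact: ltW|].
    by move=> c cut; apply/negP => rc; apply: noc; exists c.
  have k2 : 0 < P.2.[u.2] * P.2.[s].
    apply: ivt_noroot; [exact: i2|exact: ltW|].
    move=> y /andP[uy ys]; apply/negP => ry; have [x [rx ex px]] := R2 _ ry.
    have px2 := prt _ _ rx ry px; apply: noc; exists x => //.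
    rewrite -subr_ge0 (sgz_ge0E (px2 _ uz)) subr_ge0 uy /=.
    by rewrite -subr_ge0 (sgz_ge0E (ordx _ _ rx ex)) subr_ge0.
  by rewrite -(sgz_mul_gt0 k1) -(sgz_mul_gt0 k2); apply: aP2.
have nod d : t <= d <= v.1 -> ~~ root P.1 d.
  move=> /andP[td dv]; apply/negP => rd.
  have cd : c < d.
    rewrite lt_neqAle (le_trans ct td) andbT; apply: contraNneq nr => cd.
    suff -> : t = c by [].
    by apply/eqP; rewrite eq_le ct cd td.
  have [b /andP[cb bd] /d1[a /zz2 /nb + ea]] := ivt_rolle P10 i1 j1 cd rc rd.
  rewrite ea; case; first by rewrite leNgt (le_lt_trans uc cb).
  by rewrite leNgt (lt_le_trans bd dv).
have k1 : 0 < P.1.[t] * P.1.[v.1] by apply: ivt_noroot => //; [exact: i1|exact: ltW].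
have k2 : 0 < P.2.[s] * P.2.[v.2].
  apply: ivt_noroot; [exact: i2|exact: ltW|].
  move=> y /andP[sy yv]; apply/negP => ry; have [x [rx ex px]] := R2 _ ry.
  have px2 := prt _ _ rx ry px; suff /nod : t <= x <= v.1 by rewrite rx.
  rewrite -subr_le0 (sgz_le0E (ordx _ _ rx ex)) subr_le0 sy /=.
  by rewrite -subr_le0 (sgz_le0E (px2 _ vz)) subr_le0.
by rewrite (sgz_mul_gt0 k1) (sgz_mul_gt0 k2); apply: aP2.
Qed.
End MatchingCons.

(** * Specialisation to real points *)

Import Pdiv.Ring Pdiv.ComRing.

Lemma rcf_ivt_dvd (R : rcfType) (p : {poly R}) : ivt_dvd p.
Proof.
move=> q _ a b ab qab; have [c cab rc] := poly_ivtoo (ltW ab) qab.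
by exists c.
Qed.

Lemma nneg_morph_sgz (K L : realFieldType) (i : {rmorphism K -> L}) :
  nneg_morph i -> forall c, sgz (i c) = sgz c.
Proof.
move=> h c; case: (ltrgt0P c) => hc.
- by rewrite !gtr0_sgz // lt_neqAle eq_sym fmorph_eq0 gt_eqF // h // ltW.
- have := h (- c); rewrite rmorphN !oppr_ge0 ltW // => /(_ isT) hi.
  by rewrite !ltr0_sgz // lt_neqAle hi fmorph_eq0 lt_eqF.
- by rewrite hc rmorph0 !sgz0.
Qed.

Section Reduction.
Variables (A : comNzRingType) (K : fieldType) (alpha : {rmorphism A -> K}).

(** This drops the top coefficients that [alpha] kills, so that the new leading coefficient survives
    in [K]. *)
Definition reduct (r : {poly A}) : {poly A} := \poly_(i < size (map_poly alpha r)) r`_i.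

Lemma size_red r : (size (reduct r) <= size r)%N.
Proof.
apply: (leq_trans (size_poly _ _)); exact: size_poly.
Qed.

Lemma lead_coef_red r : map_poly alpha r != 0 -> alpha (lead_coef (reduct r)) != 0.
Proof.
move=> r0; have h : alpha r`_(size (map_poly alpha r)).-1 != 0.
  by rewrite -coef_map -/(lead_coef _) lead_coef_eq0.
rewrite /reduct lead_coef_poly ?size_poly_gt0 //.
by apply: contraNneq h => ->; rewrite rmorph0.
Qed.

Lemma map_red (S : nzRingType) (beta : {rmorphism A -> S}) (r : {poly A}) :
  (forall c, c \in (r : seq A) -> alpha c = 0 -> beta c = 0) ->
  map_poly beta (reduct r) = map_poly beta r.
Proof.
move=> h; apply/polyP => i; rewrite !coef_map /reduct coef_poly.
case: ltnP => // le; rewrite /= rmorph0; apply/esym.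
have [lt|ge] := ltnP i (size r); last by rewrite nth_default ?rmorph0.
by apply: h; [exact: mem_nth|rewrite -coef_map nth_default].
Qed.
End Reduction.

(** * Transfer of sign tables by elimination on the degree *)

Section Hormander.
Variables (R : rcfType) (A : comNzRingType) (K : realFieldType) (alpha : {rmorphism A -> K}).

Definition family_pair (L : realFieldType) (al : {rmorphism A -> L}) (be : {rmorphism A -> R})
    (F : seq {poly A}) : seq ({poly L} * {poly R}) :=
  [seq (map_poly al p, map_poly be p) | p <- F].

Definition agree_on (be : {rmorphism A -> R}) (C : seq A) :=
  forall c, c \in C -> sgz (be c) = sgz (alpha c).

(** [C] and [W] come before [L] and [be]: later [L] is built by adjoining roots for the product of
    [W], and [be] is chosen to have the right signs on [C]. *)
Definition transferable (F : seq {poly A}) := exists (C : seq A) (W : seq {poly A}),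
  (forall w, w \in W -> map_poly alpha w != 0) /\
  forall (L : realFieldType) (al : {rmorphism A -> L}) (be : {rmorphism A -> R}),
    (forall a, sgz (al a) = sgz (alpha a)) ->
    (forall w, w \in W -> ivt_dvd (map_poly al w)) -> agree_on be C ->
    exists z, matching (family_pair al be F) z.

Definition lead_kept (p : {poly A}) := alpha (lead_coef p) != 0.

Lemma lead_kept_map_neq0 p : lead_kept p -> map_poly alpha p != 0.
Proof.
by move=> g; rewrite -lead_coef_eq0 lead_coef_map_eq.
Qed.

Lemma lead_kept_sign_compatible (L : realFieldType) (al : {rmorphism A -> L}) (be : {rmorphism A -> R}) p :
  (forall a, sgz (al a) = sgz (alpha a)) -> sgz (be (lead_coef p)) = sgz (alpha (lead_coef p)) ->
  lead_kept p -> ivt_dvd (map_poly al p) -> sign_compatible (map_poly al p, map_poly be p).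
Proof.
move=> ha hb gp ip.
have a0 : al (lead_coef p) != 0 by rewrite (sgz_eq0E (ha _)).
have b0 : be (lead_coef p) != 0 by rewrite (sgz_eq0E hb).
split=> /=.
- by rewrite -lead_coef_eq0 lead_coef_map_eq.
- by rewrite -lead_coef_eq0 lead_coef_map_eq.
- by rewrite !size_map_poly_id0.
- by rewrite !lead_coef_map_eq // hb ha.
- by split => //; apply: rcf_ivt_dvd.
Qed.

Lemma transferable_const p F : lead_kept p -> (size p <= 1)%N -> transferable F ->
  transferable (p :: F).
Proof.
move=> gp /size1_polyC ep [C [W [hW hF]]].
exists (p`_0 :: C), W; split => // L al be ha hW' hC.
have [|z [m1 m2 m3 m4 m5]] := hF L al be ha hW'.
  by move=> c cC; apply: hC; rewrite inE cC orbT.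
have g0 : alpha p`_0 != 0 by move: gp; rewrite /lead_kept ep lead_coefC coefC.
have hb : sgz (be p`_0) = sgz (alpha p`_0) by apply: hC; exact: mem_head.
have a0 : al p`_0 != 0 by rewrite (sgz_eq0E (ha _)).
have b0 : be p`_0 != 0 by rewrite (sgz_eq0E hb).
exists z; split => //.
- move=> u /m2[P PF rP]; exists P => //; by rewrite inE PF orbT.
- move=> P t; rewrite inE => /predU1P[->/=|]; last exact: m3.
  by rewrite ep map_polyC rootC (negPf a0).
- move=> P t; rewrite inE => /predU1P[->/=|]; last exact: m4.
  by rewrite ep map_polyC rootC (negPf b0).
- move=> t s ts P; rewrite inE => /predU1P[->/=|]; last exact: m5.
  by rewrite ep !map_polyC !hornerC ha hb.
Qed.

Definition remainders (p : {poly A}) (Q : seq {poly A}) :=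
  [seq reduct alpha (rmodp p q) | q <- Q & map_poly alpha (rmodp p q) != 0].

(** At a root of [q], pseudo-division equates [p] times a power of the leading coefficient of [q]
    with the remainder; the sign of that coefficient is prescribed on both sides. *)
Lemma remainder_sgn (L : realFieldType) (al : {rmorphism A -> L}) (be : {rmorphism A -> R})
    p q (u : L * R) :
  (forall a, sgz (al a) = sgz (alpha a)) ->
  agree_on be (lead_coef q :: rmodp p q) -> lead_kept q ->
  (map_poly alpha (rmodp p q) != 0 ->
     sgz (map_poly al (reduct alpha (rmodp p q))).[u.1] =
     sgz (map_poly be (reduct alpha (rmodp p q))).[u.2]) ->
  root (map_poly al q) u.1 -> root (map_poly be q) u.2 ->
  sgz (map_poly al p).[u.1] = sgz (map_poly be p).[u.2].
Proof.
move=> ha hb gq hr r1 r2.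
have hbl : sgz (be (lead_coef q)) = sgz (alpha (lead_coef q)) by apply: hb; rewrite mem_head.
have hbc c : c \in (rmodp p q : seq A) -> alpha c = 0 -> be c = 0.
  move=> cq c0; have := hb c; rewrite inE cq orbT c0 sgz0 => /(_ isT)/eqP.
  by rewrite sgz_eq0 => /eqP.
have hac c : c \in (rmodp p q : seq A) -> alpha c = 0 -> al c = 0.
  by move=> _ c0; have := ha c; rewrite c0 sgz0 => /eqP; rewrite sgz_eq0 => /eqP.
have E (S : realFieldType) (f : {rmorphism A -> S}) v : root (map_poly f q) v ->
    f (lead_coef q) ^+ rscalp p q * (map_poly f p).[v] = (map_poly f (rmodp p q)).[v].
  move=> rv; have := congr1 (fun r => (map_poly f r).[v]) (rdivp_eq q p).
  by rewrite /= map_polyZ rmorphD rmorphM /= hornerZ hornerD hornerM (rootP rv) mulr0 add0r rmorphXn.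
have e1 := congr1 (@sgz L) (E _ al _ r1); have e2 := congr1 (@sgz R) (E _ be _ r2).
have er : sgz (map_poly al (rmodp p q)).[u.1] = sgz (map_poly be (rmodp p q)).[u.2].
  have [r0|rn0] := eqVneq (map_poly alpha (rmodp p q)) 0; last first.
    by rewrite -(map_red hac) -(map_red hbc); apply: hr.
  have z0 i : alpha (rmodp p q)`_i = 0 by rewrite -coef_map r0 coef0.
  have -> : map_poly al (rmodp p q) = 0.
    apply/polyP => i; rewrite coef_map coef0 /=.
    by have := ha (rmodp p q)`_i; rewrite z0 sgz0 => /eqP; rewrite sgz_eq0 => /eqP.
  have -> : map_poly be (rmodp p q) = 0.
    apply/polyP => i; rewrite coef_map coef0 /=.
    have [lt|ge] := ltnP i (size (rmodp p q)); last by rewrite nth_default ?rmorph0.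
    by apply: hbc => //; apply: mem_nth.
  by rewrite !horner0 !sgz0.
move: e1 e2; rewrite er !sgzM !sgzX ha hbl => <- /mulfI; move=> -> //.
by rewrite expf_eq0 negb_and sgz_eq0 (negPf gq) orbT.
Qed.

(** The outer induction bounds all sizes, the inner one runs over the polynomials of top size. Such
    a [p] is traded for its derivative and its reduced remainders modulo the other polynomials and
    that derivative, all of which fall below the top size. *)
Lemma transferable_lead_kept F : (forall p, p \in F -> lead_kept p) -> transferable F.
Proof.
suff H N : forall F, (forall p, p \in F -> lead_kept p) -> (forall p, p \in F -> (size p <= N)%N) ->
    transferable F.
  move=> gF; apply: (H (\max_(p <- F) size p)) => // p pF.
  exact: leq_bigmax_seq.
elim: N => [|N IHN] {}F gF sF.
  exists [::], [::]; split => // L al be _ _ _; exists [::].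
  have -> : F = [::].
    case: F gF sF => // p F gF sF; have := gF p (mem_head _ _).
    have := sF p (mem_head _ _); rewrite leqn0 size_poly_eq0 => /eqP ->.
    by rewrite /lead_kept lead_coef0 rmorph0 eqxx.
  by split.
suff H : forall tops rest, (forall p, p \in tops ++ rest -> lead_kept p) ->
    (forall p, p \in tops -> (size p <= N.+1)%N) -> (forall p, p \in rest -> (size p <= N)%N) ->
    transferable (tops ++ rest).
  by rewrite -[F]cats0; apply: H; rewrite ?cats0.
elim=> [|p tops IH] rest g st sr; first exact: IHN.
have gp : lead_kept p by apply: g; rewrite mem_head.
have gQ q : q \in tops ++ rest -> lead_kept q by move=> h; apply: g; rewrite inE h orbT.
have st' q : q \in tops -> (size q <= N.+1)%N by move=> h; apply: st; rewrite inE h orbT.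
have [s1|s1] := leqP (size p) 1.
  by apply: transferable_const => //; apply: IH.
pose p' := p^`().
have szp : (size p <= N.+1)%N by apply: st; rewrite mem_head.
have gp' : lead_kept p'.
  have lc : lead_coef p = p`_(size p).-2.+1 by rewrite lead_coefE -subn1; congr _`_ _; lia.
  have a0 : alpha p'`_(size p).-2 != 0.
    by rewrite coef_deriv -lc rmorphMn -mulr_natr mulf_neq0 // pnatr_eq0.
  have sp' : size p' = (size p).-1.
    apply/eqP; rewrite eqn_leq; apply/andP; split.
      have := lt_size_deriv (p := p); rewrite -size_poly_gt0 /p'; lia.
    have : ((size p).-2 < size p')%N by rewrite ltnNge; apply: contraNN a0 => h; rewrite nth_default // rmorph0.
    by lia.
  by rewrite /lead_kept lead_coefE sp'.
have sp' : (size p' <= N)%N.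
  have := lt_size_deriv (p := p); rewrite -size_poly_gt0 /p' => /(_ ltac:(lia)); lia.
pose Qs := tops ++ (rest ++ [:: p']).
have gQs q : q \in Qs -> lead_kept q.
  rewrite !mem_cat inE => /or3P[h|h|/eqP ->//]; apply: gQ; by rewrite mem_cat h ?orbT.
have sQs q : q \in Qs -> (size q <= N.+1)%N.
  rewrite !mem_cat inE => /or3P[/st'//|/sr/leqW//|/eqP ->]; exact: leqW.
pose rest' := (rest ++ [:: p']) ++ remainders p Qs.
have gR q : q \in remainders p Qs -> lead_kept q.
  by move=> /mapP[r]; rewrite mem_filter => /andP[r0 _] ->; apply: lead_coef_red.
have [|||C [W [hW hF]]] := IH rest'.
- move=> q; rewrite catA mem_cat -/Qs => /orP[/gQs//|/gR//].
- exact: st'.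
- move=> q; rewrite !mem_cat => /orP[/orP[/sr//|]|].
    by rewrite inE => /eqP ->.
  move=> /mapP[r]; rewrite mem_filter => /andP[_ rQ] ->.
  apply: (leq_trans (size_red _ _)); rewrite -ltnS.
  have r0 : r != 0 by apply: contraTneq (gQs _ rQ) => ->; rewrite /lead_kept lead_coef0 rmorph0 eqxx.
  by apply: leq_trans (sQs _ rQ); apply: ltn_rmodpN0.
pose All := p :: tops ++ rest'.
(* All coefficients of the remainders are recorded, so that [be] kills those that [alpha] kills and
   replacing a remainder by its [reduct] changes neither image. *)
exists (C ++ [seq lead_coef q | q <- All] ++ flatten [seq (rmodp p q : seq A) | q <- Qs]).
exists (W ++ All).
have gAll q : q \in All -> lead_kept q.
  by rewrite inE catA mem_cat -/Qs => /or3P[/eqP ->//|/gQs//|/gR//].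
split.
  by move=> w; rewrite mem_cat => /orP[/hW//|/gAll/lead_kept_map_neq0].
move=> L al be ha hW' hC.
have [||z mz] := hF L al be ha.
- by move=> w wW; apply: hW'; rewrite mem_cat wW.
- by move=> c cC; apply: hC; rewrite mem_cat cC.
have nAll q : q \in All -> sign_compatible (map_poly al q, map_poly be q).
  move=> qA; apply: lead_kept_sign_compatible => //; first last.
  - by apply: hW'; rewrite mem_cat qA orbT.
  - exact: gAll.
  - by apply: hC; rewrite !mem_cat map_f ?orbT.
have nF (F1 : seq {poly A}) : {subset F1 <= All} -> forall P, P \in family_pair al be F1 -> sign_compatible P.
  by move=> h P /mapP[q /h qA ->]; apply: nAll.
(* After this restriction every listed point is a root of some member of [Qs], where the sign of [p]
   can be read off from the remainder; the signs of the remainders still come from the larger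
   matching. *)
have [||z1 z1z m1] := matching_sub (G := family_pair al be Qs) _ _ mz.
- move=> P /mapP[q qQ ->]; apply: map_f; by rewrite catA mem_cat qQ.
- by apply: nF => q qq; rewrite inE qq orbT.
have QsAll : {subset Qs <= All}.
  by move=> q qQ; rewrite inE catA mem_cat qQ orbT.
have p'Qs : p' \in Qs by rewrite !mem_cat mem_head !orbT.
have [|||||z2 m2] := matching_cons (P := (map_poly al p, map_poly be p)) _ _ _ _ _ m1.
- by apply: nAll; rewrite mem_head.
- by have [_ _ _ _ []] := nAll p' (QsAll _ p'Qs); rewrite /= deriv_map.
- exact: rcf_ivt_dvd.
- rewrite /= !deriv_map; exact: (map_f (fun q => (map_poly al q, map_poly be q)) p'Qs).
- move=> u uz1 /=; have [_ m1r _ _ _] := m1.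
  have [P /mapP[q qQ ->] /= /andP[r1 r2]] := m1r _ uz1.
  apply: (remainder_sgn (q := q)) => //.
  + move=> c; rewrite inE => /predU1P[->|cq]; apply: hC.
      by rewrite !mem_cat (map_f lead_coef (QsAll _ qQ)) !orbT.
    rewrite !mem_cat; apply/orP; right; apply/orP; right.
    by apply/flattenP; exists (rmodp p q : seq A) => //; apply: (map_f (fun q => rmodp p q : seq A)).
  + exact: gQs.
  + move=> r0; have [o1 _ _ _ o5] := mz.
    have := o5 _ _ (o1 _ (z1z _ uz1))
      (map_poly al (reduct alpha (rmodp p q)), map_poly be (reduct alpha (rmodp p q))).
    apply; apply: (map_f (fun q => (map_poly al q, map_poly be q))).
    rewrite !mem_cat; apply/orP; right; apply/orP; right.
    by apply/mapP; exists q => //; rewrite mem_filter r0.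
have [||z3 _ m3] := matching_sub (G := family_pair al be (p :: tops ++ rest)) _ _ m2.
- move=> P /mapP[q qq ->]; rewrite (map_f (fun q => (map_poly al q, map_poly be q)) (_ : q \in p :: Qs)) //.
  by move: qq; rewrite !inE !mem_cat => /or3P[->|->|->]; rewrite ?orbT.
- move=> P PF; apply: (nF (p :: Qs)) PF => q; rewrite inE => /predU1P[->|/QsAll//].
  exact: mem_head.
by exists z3.
Qed.
End Hormander.

Section ArtinLang.
Variable R : rcfType.

Definition evalp (A : comNzRingType) (S : comNzRingType) (al : {rmorphism A -> S}) (t : S) :
  {rmorphism {poly A} -> S} := horner_eval t \o map_poly al.

Lemma evalpE (A S : comNzRingType) (al : {rmorphism A -> S}) t p :
  evalp al t p = (map_poly al p).[t].
Proof. by []. Qed.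

Definition realizable (A : comNzRingType) (j : {rmorphism R -> A}) (K : realFieldType)
    (al : {rmorphism A -> K}) :=
  forall C : seq A, exists be : {rmorphism A -> R},
    (forall r, be (j r) = r) /\ forall c, c \in C -> sgz (be c) = sgz (al c).

(** One more coordinate: once the signs of finitely many coefficients are realised in [R], the sign
    tables over an extension of [K] and over [R] coincide, and t is replaced by a real number in the
    same position. *)
Lemma realizable_poly (A : comNzRingType) (j : {rmorphism R -> A}) (K : realFieldType)
    (al : {rmorphism A -> K}) (t : K) :
  realizable j al -> realizable (polyC \o j : {rmorphism R -> {poly A}}) (evalp al t).
Proof.
move=> AL F.
pose F1 := [seq reduct al f | f <- F & map_poly al f != 0].
have [|C [W [hW hF]]] := @transferable_lead_kept R A K al F1.
  by move=> p /mapP[f]; rewrite mem_filter => /andP[f0 _] ->; apply: lead_coef_red.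
have [|L [i [ni ivt]]] := @ordered_ext_ivt K (\prod_(w <- W) map_poly al w).
  rewrite prodf_seq_neq0; apply/allP => w /hW; by rewrite /= => ->.
(* The coefficients of [F] are included so that passing to reducts is harmless for [be] too. *)
have [be [bej hb]] := AL (C ++ flatten [seq polyseq (f : {poly A}) | f <- F]).
have sg := nneg_morph_sgz ni.
have [|||z [m1 _ _ _ m5]] := hF L (i \o al : {rmorphism A -> L}) be.
- by move=> a /=; apply: sg.
- move=> w wW p pw; apply: ivt; apply: (dvdp_trans pw).
  rewrite map_poly_comp dvdp_map (big_rem w) //= dvdp_mulr //.
- by move=> c cC; apply: hb; rewrite mem_cat cC.
have [s ps] := same_position_exists (i t) m1.
exists (evalp be s); split => [r|f fF]; first by rewrite evalpE /= map_polyC hornerC /= bej.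
have hbc c : c \in polyseq f -> al c = 0 -> be c = 0.
  move=> cf c0; have := hb c; rewrite mem_cat c0 sgz0.
  have -> : c \in flatten [seq polyseq (f : {poly A}) | f <- F].
    by apply/flattenP; exists (polyseq f) => //; apply: map_f.
  by rewrite orbT => /(_ isT)/eqP; rewrite sgz_eq0 => /eqP.
rewrite !evalpE; have [f0|fn0] := eqVneq (map_poly al f) 0.
  have -> : map_poly be f = 0.
    apply/polyP => k; rewrite coef_map coef0 /=.
    have [lt|ge] := ltnP k (size f); last by rewrite nth_default ?rmorph0.
    by apply: hbc; [exact: mem_nth|rewrite -coef_map f0 coef0].
  by rewrite f0 !horner0 !sgz0.
rewrite -(map_red hbc) -(@map_red _ _ al _ al f) // -sg -horner_map -map_poly_comp.
apply/esym; apply: (m5 _ _ ps (map_poly (i \o al) (reduct al f), map_poly be (reduct al f))).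
apply: (map_f (fun q => (map_poly (i \o al) q, map_poly be q))).
by apply/mapP; exists f => //; rewrite mem_filter fn0.
Qed.

(** The ring is an iterated univariate polynomial ring, so that coordinates can be treated one at a
    time. *)
Lemma realizable_tower (K : realFieldType) (i : {rmorphism R -> K}) n (x : 'I_n -> K) :
  nneg_morph i ->
  exists (A : comNzRingType) (j : {rmorphism R -> A}) (al : {rmorphism A -> K}) (X : 'I_n -> A),
    [/\ forall r, al (j r) = i r, forall l, al (X l) = x l & realizable j al].
Proof.
move=> ni; elim: n x => [|n IH] x.
  exists R, (idfun : {rmorphism R -> R}), i, (fun _ => 0); split => //; first by case.
  move=> C; exists (idfun : {rmorphism R -> R}); split => // c _.
  by rewrite (nneg_morph_sgz ni).
have [A [j [al [X [h1 h2 h3]]]]] := IH (fun l => x (lift ord0 l)).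
exists ({poly A} : comNzRingType), (polyC \o j : {rmorphism R -> {poly A}}), (evalp al (x ord0)).
exists (fun l => if unlift ord0 l is Some l' then (X l')%:P else 'X); split.
- by move=> r; rewrite evalpE /= map_polyC hornerC /= h1.
- move=> l; rewrite evalpE; case: unliftP => [l' ->|->].
    by rewrite map_polyC hornerC /= h2.
  by rewrite map_polyX hornerX.
- exact: realizable_poly.
Qed.
End ArtinLang.

(** * Derivations and critical values *)

Section MpolyRingInd.
Variables (R : nzRingType) (n : nat) (P : {mpoly R[n]} -> Prop).
Hypotheses (PC : forall c, P c%:MP) (PX : forall l, P 'X_l)
  (PD : forall p q, P p -> P q -> P (p + q)) (PM : forall p q, P p -> P q -> P (p * q)).

Lemma mpoly_ring_ind p : P p.
Proof.
have P1 : P 1 by rewrite -mpolyC1; apply: PC.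
rewrite [p]mpolyE; apply: big_ind => //; first by rewrite -mpolyC0; apply: PC.
move=> m _; rewrite -mul_mpolyC; apply: (PM) => //.
rewrite mpolyXE_id; apply: big_ind => // l _.
by elim: (m l) => [|k IH]; rewrite ?expr0 ?exprS //; apply: (PM).
Qed.
End MpolyRingInd.

Lemma mpoly_morph_ext (R S : nzRingType) n (f g : {rmorphism {mpoly R[n]} -> S}) :
  (forall c, f c%:MP = g c%:MP) -> (forall l, f 'X_l = g 'X_l) -> f =1 g.
Proof.
move=> hC hX p; elim/mpoly_ring_ind: p => //.
- by move=> p q hp hq; rewrite !rmorphD hp hq.
- by move=> p q hp hq; rewrite !rmorphM hp hq.
Qed.

Lemma artin_lang (R : rcfType) n (K : realFieldType) (al : {rmorphism {mpoly R[n]} -> K}) :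
  (forall r : R, 0 <= r -> 0 <= al r%:MP) -> forall F : seq {mpoly R[n]},
  exists a : 'I_n -> R, forall q, q \in F -> sgz q.@[a] = sgz (al q).
Proof.
move=> h F; pose i : {rmorphism R -> K} := al \o (@mpolyC n R).
have [A [j [be [X [h1 h2 h3]]]]] := @realizable_tower R K i n (fun l => al 'X_l) h.
have [ga [g1 g2]] := h3 [seq mmap j X q | q <- F].
exists (ga \o X) => q qF.
have e1 : be (mmap j X q) = al q.
  apply: (@mpoly_morph_ext _ _ _ (be \o mmap j X : {rmorphism {mpoly R[n]} -> K}) al).
    by move=> c /=; rewrite mmapC h1.
  by move=> l /=; rewrite mmapX mmap1U h2.
have e2 : ga (mmap j X q) = q.@[ga \o X].
  apply: (@mpoly_morph_ext _ _ _ (ga \o mmap j X : {rmorphism {mpoly R[n]} -> R})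
    (meval (ga \o X))).
    by move=> c /=; rewrite mmapC g1 mevalC.
  by move=> l /=; rewrite mmapX mmap1U mevalXU.
by rewrite -e1 -e2; apply: g2; apply: map_f.
Qed.

(** The last clause makes [d] factor through the image of [al]: it is a derivation of that subring
    with values in [K]. *)
Definition derivation_along (A K : nzRingType) (al d : A -> K) :=
  [/\ forall a b, d (a + b) = d a + d b,
      forall a b, d (a * b) = al a * d b + al b * d a &
      forall a, al a = 0 -> d a = 0].

Section DerivationExtension.
Variables (A : comNzRingType) (K : realFieldType) (al : {rmorphism A -> K}) (d : A -> K) (y : K).
Hypothesis der : derivation_along al d.

Let dD : forall a b, d (a + b) = d a + d b. Proof. by case: der. Qed.
Let dM : forall a b, d (a * b) = al a * d b + al b * d a. Proof. by case: der. Qed.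
Let d0 : d 0 = 0. Proof. by case: der => _ _; apply; rewrite rmorph0. Qed.

Let D0 (p : {poly A}) : K := (map_poly d p).[y].
Let E (p : {poly A}) : K := evalp al y p.

Let D0D p q : D0 (p + q) = D0 p + D0 q.
Proof.
rewrite /D0 -hornerD; congr horner; apply/polyP => i.
by rewrite coefD !coef_map_id0 // coefD dD.
Qed.

Let D0MX p : D0 (p * 'X) = D0 p * y.
Proof.
rewrite /D0; have -> : map_poly d (p * 'X) = map_poly d p * 'X.
  by apply/polyP => i; rewrite coefMX !coef_map_id0 // coefMX; case: i.
by rewrite hornerM hornerX.
Qed.

Let D0C c : D0 c%:P = d c.
Proof.
rewrite /D0; have -> : map_poly d c%:P = (d c)%:P; last by rewrite hornerC.
by apply/polyP => i; rewrite coef_map_id0 // !coefC; case: (i == 0)%N.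
Qed.

Let D0CM c q : D0 (c%:P * q) = al c * D0 q + E q * d c.
Proof.
rewrite /D0 /E evalpE.
have -> : map_poly d (c%:P * q) = (al c)%:P * map_poly d q + map_poly al q * (d c)%:P.
  apply/polyP => i; rewrite coefD coefCM coefMC !coef_map_id0 ?rmorph0 //.
  by rewrite coefCM dM.
by rewrite hornerD !hornerM !hornerC.
Qed.

Let D0M p q : D0 (p * q) = E p * D0 q + E q * D0 p.
Proof.
elim/poly_ind: p => [|p c IH].
  by rewrite mul0r -polyC0 D0C d0 /E rmorph0; ring.
rewrite mulrDl D0D D0CM mulrAC D0MX IH D0D D0MX D0C.
have -> : E (p * 'X + c%:P) = E p * y + al c.
  by rewrite /E !evalpE rmorphD rmorphM /= map_polyX map_polyC hornerD hornerM hornerX hornerC.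
ring.
Qed.

(** An extension is determined by its value v at X. If y is transcendental over the image, any v
    works. If y is algebraic, v is forced by a polynomial of least degree vanishing at y; the
    derivative of that polynomial is nonzero at y by minimality and characteristic zero. *)
Lemma derivation_extend : exists d' : {poly A} -> K,
  derivation_along (evalp al y) d' /\ forall c, d' c%:P = d c.
Proof.
pose Dv v p := D0 p + v * E p^`().
have DvD v p q : Dv v (p + q) = Dv v p + Dv v q.
  by rewrite /Dv D0D derivD /E rmorphD /=; ring.
have DvM v p q : Dv v (p * q) = E p * Dv v q + E q * Dv v p.
  by rewrite /Dv D0M derivM /E rmorphD !rmorphM /=; ring.
have DvC v c : Dv v c%:P = d c.
  by rewrite /Dv D0C derivC /E rmorph0 mulr0 addr0.
have triv v q : map_poly al q = 0 -> Dv v q = 0.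
  move=> q0; have z0 i : al q`_i = 0 by rewrite -coef_map q0 coef0.
  have dz i : d q`_i = 0 by case: der => _ _; apply.
  have -> : Dv v q = D0 q + v * (map_poly al q)^`().[y].
    by rewrite /Dv /E evalpE deriv_map.
  rewrite q0 deriv0 horner0 mulr0 addr0 /D0.
  suff -> : map_poly d q = 0 by rewrite horner0.
  by apply/polyP => i; rewrite coef_map_id0 // dz coef0.
suff [v hv] : exists v, forall q, E q = 0 -> Dv v q = 0.
  by exists (Dv v); split => //; split => //.
have [[q [q0 Eq]]|no] := pselect (exists q, map_poly al q != 0 /\ E q = 0); last first.
  exists 0 => q Eq; apply: triv; apply/eqP/negPn/negP => q0.
  by apply: no; exists q.
pose annihilated m := exists q, [/\ map_poly al q != 0, E q = 0 & size (map_poly al q) = m].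
have [m [[q1 [q10 Eq1 sm]] mmin]] : exists m, annihilated m /\ forall m', (m' < m)%N -> ~ annihilated m'.
  have : annihilated (size (map_poly al q)) by exists q.
  move: (size _); elim/ltn_ind => m IH gm.
  have [[m' [lt gm']]|no] := pselect (exists m', (m' < m)%N /\ annihilated m').
    exact: IH gm'.
  by exists m; split => // m' lt gm'; apply: no; exists m'.
pose q2 := reduct al q1.
have mq2 : map_poly al q2 = map_poly al q1 by apply: map_red.
have lc2 : al (lead_coef q2) != 0 by apply: lead_coef_red.
have s2 : size q2 = m by rewrite -sm -mq2 size_map_poly_id0.
have Eq2 : E q2 = 0 by rewrite /E evalpE mq2.
have small q' : (size (map_poly al q') < m)%N -> E q' = 0 -> map_poly al q' = 0.
  move=> lt Eq'; apply/eqP/negPn/negP => nz.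
  by apply: (mmin _ lt); exists q'.
have sm1 : (1 < size (map_poly al q2))%N.
  rewrite ltnNge; apply/negP => /size1_polyC e; move: Eq2; rewrite /E evalpE e hornerC => c0.
  by move: q10; rewrite -mq2 e c0 eqxx.
have Ed : E q2^`() != 0.
  apply/eqP => Ed.
  have lt : (size (map_poly al q2^`()) < m)%N.
    rewrite -deriv_map -sm -mq2; apply: lt_size_deriv.
    by rewrite -size_poly_gt0 ltnW.
  have := small _ lt Ed; rewrite -deriv_map => /polyP/(_ (size (map_poly al q2)).-2).
  rewrite coef_deriv coef0 => /eqP; rewrite -mulr_natr mulf_eq0 pnatr_eq0 orbF.
  have -> : (size (map_poly al q2)).-2.+1 = (size (map_poly al q2)).-1 by lia.
  by rewrite -lead_coefE lead_coef_eq0 mq2 (negPf q10).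
exists (- D0 q2 / E q2^`()); set v := - _ / _ => q' Eq'.
have Dv2 : Dv v q2 = 0 by rewrite /Dv /v mulfVK ?subrr.
(* Modulo [q2], the remainder of [q'] also vanishes at y and has smaller degree, so its image is
   zero and [Dv] kills it; what is left is a power of the leading coefficient times the value
   sought. *)
have := congr1 (Dv v) (rdivp_eq q2 q'); have := congr1 E (rdivp_eq q2 q').
have ED a b : E (a + b) = E a + E b by rewrite /E rmorphD.
have EM a b : E (a * b) = E a * E b by rewrite /E rmorphM.
rewrite -!mul_polyC ED !EM Eq2 Eq' !mulr0 add0r => /esym Er.
rewrite DvD !DvM Dv2 Eq' Eq2 !(mul0r, mulr0, addr0, add0r) (triv v (rmodp q' q2)); last first.
  apply: small => //; apply: (leq_ltn_trans (size_poly _ _)); rewrite -s2.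
  by apply: ltn_rmodpN0; rewrite -size_poly_gt0 s2; case: (m) sm sm1 => //; rewrite mq2 => ->.
move/eqP; rewrite mulf_eq0 => /orP[|/eqP//].
by rewrite /E evalpE map_polyC hornerC /= rmorphXn expf_eq0 (negPf lc2) andbF.
Qed.
End DerivationExtension.

(** Start from d/dT on R[T], where transcendence of [tau] makes evaluation injective, and extend
    coordinate by coordinate. *)
Lemma derivation_tower (R : fieldType) (K : realFieldType) (i : {rmorphism R -> K}) (tau : K)
    n (x : 'I_n -> K) :
  (forall p : {poly R}, p != 0 -> (map_poly i p).[tau] != 0) ->
  exists (A : comNzRingType) (j : {rmorphism R -> A}) (al : {rmorphism A -> K}) (d : A -> K)
    (T : A) (X : 'I_n -> A),
    [/\ derivation_along al d, forall r, al (j r) = i r /\ d (j r) = 0,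
        al T = tau /\ d T = 1 & forall l, al (X l) = x l].
Proof.
move=> tr; elim: n x => [|n IH] x.
  exists {poly R}, (@polyC R), (evalp i tau), (fun p => evalp i tau p^`()), 'X, (fun _ => 0).
  split; last by case.
  - split=> [a b|a b|a].
    + by rewrite derivD rmorphD.
    + by rewrite derivM rmorphD !rmorphM /=; ring.
    + rewrite evalpE => /eqP; have [->|a0] := eqVneq a 0; last by rewrite (negPf (tr _ a0)).
      by move=> _; rewrite deriv0 rmorph0 horner0.
  - by move=> r; rewrite derivC rmorph0 evalpE map_polyC hornerC.
  - by rewrite derivX rmorph1 evalpE map_polyX hornerX.
have [A [j [al [d [T [X [h1 h2 h3 h4]]]]]]] := IH (fun l => x (lift ord0 l)).
have [d' [der' dC]] := derivation_extend (x ord0) h1.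
have eC c : evalp al (x ord0) c%:P = al c by rewrite evalpE map_polyC hornerC.
exists ({poly A} : comNzRingType), (polyC \o j : {rmorphism R -> {poly A}}), (evalp al (x ord0)), d', T%:P.
exists (fun l => if unlift ord0 l is Some l' then (X l')%:P else 'X); split => //.
- by move=> r; rewrite [evalp _ _ _]eC /= dC.
- by rewrite eC dC.
- move=> l; case: unliftP => [l' ->|->]; first by rewrite eC.
  by rewrite evalpE map_polyX hornerX.
Qed.

Lemma mderivXU (R : nzRingType) n (k l : 'I_n) : ('X_k : {mpoly R[n]})^`M(l) = (k == l)%:R.
Proof.
rewrite mderivX mnm1E; have [<-|_] := eqVneq k l; last by rewrite scale0r.
have -> : (U_(k) - U_(k) = 0 :> 'X_{1..n})%MM by apply/mnmP => i; rewrite !mnmE subnn.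
by rewrite mpolyX0 scale1r.
Qed.

Lemma derivation_mpoly (R : comNzRingType) n (K : comNzRingType) (al : {rmorphism {mpoly R[n]} -> K})
    (D : {mpoly R[n]} -> K) :
  (forall a b, D (a + b) = D a + D b) -> (forall a b, D (a * b) = al a * D b + al b * D a) ->
  (forall c, D c%:MP = 0) ->
  forall q, D q = \sum_(l < n) al q^`M(l) * D 'X_l.
Proof.
move=> DD DM DC; apply: mpoly_ring_ind.
- by move=> c; rewrite DC big1 // => l _; rewrite mderivC rmorph0 mul0r.
- move=> l; rewrite (bigD1 l) //= big1 ?addr0 => [|k kl].
    by rewrite mderivXU eqxx rmorph1 mul1r.
  by rewrite mderivXU eq_sym (negPf kl) rmorph0 mul0r.
- move=> p q hp hq; rewrite DD hp hq -big_split; apply: eq_bigr => l _ /=.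
  by rewrite mderivD rmorphD mulrDl.
- move=> p q hp hq; rewrite DM hp hq !mulr_sumr -big_split; apply: eq_bigr => l _ /=.
  by rewrite mderivM rmorphD !rmorphM /=; ring.
Qed.

Section Critical.
Variables (R : realType) (n me mi : nat) (f : {mpoly R[n]})
  (ceq p_eq : 'I_me -> {mpoly R[n]}) (cin p_in : 'I_mi -> {mpoly R[n]}).

(* On the critical variety df = sum_i p_i dc_i vanishes along every derivation of
   the residue field, so f is algebraic over the constants. *)
Lemma critical_value_algebraic (K : realFieldType) (al : {rmorphism {mpoly R[n]} -> K}) :
  (forall i, al (ceq i) = 0) -> (forall q, q \in phi f ceq cin p_eq p_in -> al q = 0) ->
  exists2 p : {poly R}, p != 0 & (map_poly (al \o @mpolyC n R) p).[al f] = 0.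
Proof.
move=> hc hphi; apply: contrapT => no.
have tr (p : {poly R}) : p != 0 -> (map_poly (al \o @mpolyC n R) p).[al f] != 0.
  by move=> p0; apply/negP => /eqP e; apply: no; exists p.
have [A [j [be [d [T [X [der hj [T1 T2] hX]]]]]]] :=
  @derivation_tower R K (al \o @mpolyC n R) (al f) n (fun l => al 'X_l) tr.
have [dD dM dker] := der.
pose g : {rmorphism {mpoly R[n]} -> A} := mmap j X.
have gC c : g c%:MP = j c by exact: mmapC.
have bg q : be (g q) = al q.
  apply: (@mpoly_morph_ext _ _ _ (be \o g : {rmorphism {mpoly R[n]} -> K}) al).
    by move=> c; rewrite /= gC (hj c).1.
  by move=> l /=; rewrite /g mmapX mmap1U hX.
pose D q := d (g q).
have Dker q : al q = 0 -> D q = 0 by rewrite -bg; apply: dker.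
have DE := @derivation_mpoly _ _ _ al D.
have {}DE q : D q = \sum_(l < n) al q^`M(l) * D 'X_l.
  apply: DE.
  - by move=> a b; rewrite /D rmorphD dD.
  - by move=> a b; rewrite /D rmorphM dM !bg.
  - by move=> c; rewrite /D gC; have [] := hj c.
(* The lift of [f] and [T] have the same image in [K], so their difference is killed by [d]. *)
have Df1 : D f = 1.
  have : d (g f - T) = 0 by apply: dker; rewrite rmorphB bg T1 subrr.
  have dN a : d (- a) = - d a.
    have : d (a - a) = 0 by apply: dker; rewrite subrr rmorph0.
    by rewrite dD => /eqP; rewrite addr_eq0 => /eqP ->; rewrite opprK.
  by rewrite dD dN T2 => /eqP; rewrite subr_eq0 => /eqP.
have Df0 : D f = 0.
  have fl l : al f^`M(l) = \sum_(i < me) al (p_eq i) * al (ceq i)^`M(l)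
      + \sum_(k < mi) al (p_in k) * al (cin k)^`M(l).
    have := hphi (f^`M(l) - \sum_(i < me) p_eq i * (ceq i)^`M(l)
               - \sum_(j < mi) p_in j * (cin j)^`M(l)).
    have -> : f^`M(l) - \sum_(i < me) p_eq i * (ceq i)^`M(l)
               - \sum_(j < mi) p_in j * (cin j)^`M(l) \in phi f ceq cin p_eq p_in.
      by rewrite mem_cat; apply/orP; left; apply/mapP; exists l; rewrite ?mem_enum.
    move=> /(_ isT) /eqP.
    rewrite !rmorphB !rmorph_sum -addrA -opprD subr_eq0 => /eqP ->.
    by congr (_ + _); apply: eq_bigr => i _; rewrite rmorphM.
  (* The chain rule turns [D f] into the sum of p_i D c_i. For an inequality, p_j c_j = 0 in a
     field: either p_j is zero, or c_j is zero and so is its derivative. *)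
  rewrite DE; under eq_bigr => l _ do rewrite fl mulrDl !mulr_suml.
  rewrite big_split /= exchange_big [X in _ + X]exchange_big /=.
  rewrite !big1 ?addr0 // => i _; under eq_bigr => l _ do rewrite -mulrA;
    rewrite -mulr_sumr -DE.
    have /hphi : p_in i * cin i \in phi f ceq cin p_eq p_in.
      by rewrite mem_cat; apply/orP; right; apply/mapP; exists i; rewrite ?mem_enum.
    move=> /eqP; rewrite rmorphM mulf_eq0 => /orP[/eqP ->|/eqP/Dker ->].
      by rewrite mul0r.
    by rewrite mulr0.
  by rewrite Dker ?mulr0.
by move: Df1; rewrite Df0 => /eqP; rewrite eq_sym oner_eq0.
Qed.
End Critical.

(** * Certificates *)

Lemma msizeM_leq (R : idomainType) n (p q : {mpoly R[n]}) :
  (msize (p * q) <= (msize p + msize q).-1)%N.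
Proof.
have [->|p0] := eqVneq p 0; first by rewrite mul0r mmeasure0.
have [->|q0] := eqVneq q 0; first by rewrite mulr0 mmeasure0.
by rewrite msizeM.
Qed.

Section Certificates.
Variables (R : realType) (n : nat).
Local Notation poly := {mpoly R[n]}.
Variables (h g : seq poly).
Implicit Types (p q : poly) (D : nat).

(** [D] bounds the multipliers and the polynomials that are squared, not the products, so one [D]
    serves all large orders k. *)
Definition certificate D p := exists (a : 'I_(size h) -> poly) (s : {set 'I_(size g)} -> seq poly),
  [/\ forall i, (msize (a i) <= D)%N, forall r q, q \in s r -> (msize q <= D)%N &
   p = \sum_(i < size h) h`_i * a i + \sum_(r : {set 'I_(size g)}) gpow r * \sum_(q <- s r) q ^+ 2].

Lemma certificate_mono D D' p : (D <= D')%N -> certificate D p -> certificate D' p.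
Proof.
move=> le [a [s [h1 h2 ->]]]; exists a, s; split => // [i|r q /h2].
  exact: leq_trans le.
by move/leq_trans; apply.
Qed.

Lemma certificateD D p q : certificate D p -> certificate D q -> certificate D (p + q).
Proof.
move=> [a [s [h1 h2 ->]]] [a' [s' [h1' h2' ->]]].
exists (fun i => a i + a' i), (fun r => s r ++ s' r); split.
- by move=> i; rewrite (leq_trans (mmeasureD_le _ _ _)) // geq_max h1 h1'.
- by move=> r x; rewrite mem_cat => /orP[/h2|/h2'].
- under [in RHS]eq_bigr do rewrite mulrDr.
  under [X in _ = _ + X]eq_bigr do rewrite big_cat mulrDr.
  by rewrite !big_split /=; ring.
Qed.

Lemma certificate0 : certificate 0 0.
Proof.
exists (fun _ => 0), (fun _ => [::]); split => //; first by move=> i; rewrite mmeasure0.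
rewrite big1 ?add0r => [|i _]; last by rewrite mulr0.
by rewrite big1 // => r _ /=; rewrite big_nil mulr0.
Qed.

Lemma certificate_ideal i a : (i < size h)%N -> certificate (msize a) (h`_i * a).
Proof.
move=> ih; exists (fun k => if (k : nat) == i then a else 0), (fun _ => [::]); split => //.
- by move=> k; case: ifP; rewrite ?mmeasure0.
- rewrite [X in _ + X]big1 ?addr0; last by move=> r _ /=; rewrite big_nil mulr0.
  rewrite (bigD1 (Ordinal ih)) //= eqxx big1 ?addr0 // => k ki.
  have -> : (k : nat) == i = false by apply/eqP => e; move/eqP: ki; apply; apply: val_inj.
  by rewrite mulr0.
Qed.

Lemma certificate_gen (r : {set 'I_(size g)}) q : certificate (msize q) (gpow r * q ^+ 2).
Proof.
exists (fun _ => 0), (fun r' => if r' == r then [:: q] else [::]); split.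
- by move=> i; rewrite mmeasure0.
- by move=> r' q'; case: ifP => // _; rewrite inE => /eqP ->.
- rewrite big1 ?add0r => [|i _]; last by rewrite mulr0.
  rewrite (bigD1 r) //= eqxx big_seq1 big1 ?addr0 // => r' /negPf ->.
  by rewrite big_nil mulr0.
Qed.

Lemma certificate_sq q : certificate (msize q) (q ^+ 2).
Proof.
have -> : q ^+ 2 = gpow (set0 : {set 'I_(size g)}) * q ^+ 2.
  by rewrite /gpow big_set0 mul1r.
exact: certificate_gen.
Qed.

Lemma certificate_sqM D p q : certificate D p -> certificate (msize q + msize q + D) (q ^+ 2 * p).
Proof.
move=> [a [s [h1 h2 ->]]].
exists (fun i => q ^+ 2 * a i), (fun r => [seq q * x | x <- s r]); split.
- move=> i; rewrite (leq_trans (msizeM_leq _ _)) //.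
  have := msizeM_leq q q; rewrite -expr2; have := h1 i.
  by move: (msize q) (msize (q ^+ 2)) (msize (a i)) => x y z; lia.
- move=> r x /mapP[x' /h2 hx ->]; rewrite (leq_trans (msizeM_leq _ _)) //.
  by move: (msize q) (msize x') hx => y z; lia.
- rewrite mulrDr !mulr_sumr; congr (_ + _); apply: eq_bigr => i _; first by ring.
  rewrite mulrCA; congr (_ * _); rewrite big_map mulr_sumr.
  by apply: eq_bigr => x _; rewrite exprMn.
Qed.

Definition precone p := exists D, certificate D p.

Lemma preconeD p q : precone p -> precone q -> precone (p + q).
Proof.
move=> [D hD] [E hE]; exists (maxn D E); apply: certificateD.
  exact: certificate_mono (leq_maxl _ _) hD.
exact: certificate_mono (leq_maxr _ _) hE.
Qed.

Lemma precone_sum (I : Type) (s : seq I) (P : pred I) (F : I -> poly) :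
  (forall i, P i -> precone (F i)) -> precone (\sum_(i <- s | P i) F i).
Proof.
by move=> hF; apply: big_ind => //; [exists 0%N; exact: certificate0|exact: preconeD].
Qed.

(** Repeated factors are absorbed into a square, which is why square-free products of the generators
    suffice for a preordering. *)
Lemma gpowM (r r' : {set 'I_(size g)}) :
  gpow r * gpow r' = gpow ((r :\: r') :|: (r' :\: r)) * gpow (r :&: r') ^+ 2.
Proof.
rewrite /gpow (big_setID r') /= [X in _ * X](big_setID r) /= [r' :&: r]setIC.
rewrite [X in _ = X * _](_ : _ = (\prod_(i in r :\: r') g`_i) * (\prod_(i in r' :\: r) g`_i)).
  by ring.
rewrite -bigU /=; first by apply: eq_bigl => i; rewrite !inE.
by rewrite -setI_eq0; apply/eqP/setP => i; rewrite !inE; case: (i \in r); rewrite ?andbF.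
Qed.

Lemma preconeM p q : precone p -> precone q -> precone (p * q).
Proof.
move=> [D [a [s [_ _ ep]]]] hq; rewrite ep mulrDl !mulr_suml; apply: preconeD.
  by apply: precone_sum => i _; rewrite -mulrA; eexists; apply: certificate_ideal.
case: hq => E [a' [s' [_ _ ->]]].
apply: precone_sum => r _; rewrite mulrDr; apply: preconeD.
  set G := gpow r * _; rewrite mulr_sumr; apply: precone_sum => i _.
  by rewrite mulrCA; eexists; apply: certificate_ideal.
set G := gpow r * _; rewrite mulr_sumr; apply: precone_sum => r' _.
rewrite /G mulrACA gpowM big_distrlr /= mulr_sumr; apply: precone_sum => x _.
rewrite mulr_sumr; apply: precone_sum => x' _.
have -> : gpow (r :\: r' :|: r' :\: r) * gpow (r :&: r') ^+ 2 * (x ^+ 2 * x' ^+ 2) =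
  gpow (r :\: r' :|: r' :\: r) * (gpow (r :&: r') * x * x') ^+ 2 by ring.
by eexists; apply: certificate_gen.
Qed.

Lemma precone_preordering : preordering precone.
Proof.
split; [exact: preconeD|exact: preconeM|by move=> q; eexists; apply: certificate_sq].
Qed.

Lemma precone_ideal q a : q \in h -> precone (q * a).
Proof. by move=> /(nthP 0)[i ih <-]; eexists; apply: certificate_ideal. Qed.

Lemma precone_gen q : q \in g -> precone q.
Proof.
move=> /(nthP 0)[i ig <-]; have -> : g`_i = gpow [set Ordinal ig] * 1 ^+ 2.
  by rewrite /gpow big_set1 expr1n mulr1.
by eexists; apply: certificate_gen.
Qed.

Lemma certificate_or_point (M : poly -> Prop) : M 1 -> (forall a b, M a -> M b -> M (a * b)) ->
  (exists2 m, M m & precone (- m ^+ 2)) \/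
  exists (K : realFieldType) (al : {rmorphism poly -> K}),
    [/\ forall r : R, 0 <= r -> 0 <= al r%:MP, forall q, q \in h -> al q = 0,
        forall q, q \in g -> 0 <= al q & forall m, M m -> al m != 0].
Proof.
move=> M1 MM; have [ex|no] := pselect (exists2 m, M m & precone (- m ^+ 2)); first by left.
right; have [|K [al [h1 h2]]] := @real_prime_avoiding _ M M1 MM precone precone_preordering.
  by move=> m Mm hm; apply: no; exists m.
exists K, al; split => //.
- move=> r r0; apply: h1; have <- : (Num.sqrt r)%:MP ^+ 2 = r%:MP :> poly.
    by rewrite -rmorphXn /= sqr_sqrtr.
  by eexists; apply: certificate_sq.
- move=> q qh; apply/eqP; rewrite eq_le.
  have := h1 _ (precone_ideal (-1) qh); have := h1 _ (precone_ideal 1 qh).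
  by rewrite mulr1 mulrN1 rmorphN oppr_ge0 => -> ->.
- by move=> q /precone_gen/h1.
Qed.
End Certificates.

Section FiniteValues.
Variables (R : realType) (n me mi : nat) (f : {mpoly R[n]})
  (ceq p_eq : 'I_me -> {mpoly R[n]}) (cin p_in : 'I_mi -> {mpoly R[n]}).
Local Notation hs := (ceq_s ceq ++ phi f ceq cin p_eq p_in).
Local Notation gs := (gtuple cin p_in).

Lemma critical_values_certificate : exists2 vs : seq R,
  forall v, v \in vs -> fc_vals f ceq cin p_eq p_in v &
  precone hs gs (- (\prod_(v <- vs) (f - v%:MP)) ^+ 2).
Proof.
pose M (p : {mpoly R[n]}) := exists2 vs : seq R,
  forall v, v \in vs -> fc_vals f ceq cin p_eq p_in v & p = \prod_(v <- vs) (f - v%:MP).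
have [||[_ [vs hvs ->] cert]|[K [al [k1 k2 k3 k4]]]] := @certificate_or_point R n hs gs M.
- by exists [::]; rewrite ?big_nil.
- move=> _ _ [vs hv ->] [ws hw ->]; exists (vs ++ ws); last by rewrite big_cat.
  by move=> v; rewrite mem_cat => /orP[/hv|/hw].
- by exists vs.
have [||p p0 pf] := @critical_value_algebraic R n me mi f ceq p_eq cin p_in K al.
- move=> i; apply: k2; rewrite mem_cat; apply/orP; left; apply: map_f.
  by rewrite mem_enum.
- by move=> q qphi; apply: k2; rewrite mem_cat qphi orbT.
have [rs hrs] := all_roots_seq p0.
pose pf' := (map_poly (@mpolyC n R) p).[f].
(* [pf'] forces f(a) to be one of the real roots [rs]; the listed f - r for that root then has image
   zero in [K], although f(a) is a value on the feasible set and M forbids this. *)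
have [a ha] := artin_lang k1 (hs ++ gs ++ pf' :: [seq f - r%:MP | r <- rs]).
have evC (q : {poly R}) : (map_poly (@mpolyC n R) q).[f].@[a] = q.[f.@[a]].
  rewrite -horner_map /= -map_poly_comp; congr horner.
  by apply: map_poly_id => c _ /=; rewrite mevalC.
have fa : root p f.@[a].
  have := ha pf'; rewrite !mem_cat mem_head !orbT => /(_ isT).
  have -> : al pf' = 0 by rewrite -[RHS]pf map_poly_comp horner_map.
  by rewrite sgz0 => /eqP; rewrite sgz_eq0 evC.
have Sa : feasible_c f ceq cin p_eq p_in a.
  have z q : q \in hs -> q.@[a] = 0.
    move=> qh; have := ha q; rewrite mem_cat qh => /(_ isT).
    by rewrite k2 // sgz0 => /eqP; rewrite sgz_eq0 => /eqP.
  have nn q : q \in gs -> 0 <= q.@[a].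
    move=> qg; have := ha q; rewrite mem_cat [q \in gs ++ _]mem_cat qg orbT => /(_ isT) /sgz_ge0E ->.
    exact: k3.
  split; first split.
  - by move=> i; apply: z; rewrite mem_cat map_f ?mem_enum.
  - by move=> j; apply: nn; rewrite mem_cat map_f ?mem_enum.
  - split=> q qp; first by apply: z; rewrite mem_cat qp orbT.
    by apply: nn; rewrite mem_cat qp orbT.
have := k4 (f - (f.@[a])%:MP).
have -> : al (f - (f.@[a])%:MP) = 0.
  apply/eqP; rewrite -sgz_eq0 -ha; first by rewrite mevalB mevalC subrr sgz0.
  rewrite !mem_cat inE (map_f (fun r => f - r%:MP)) ?orbT //; exact: hrs.
rewrite eqxx; case/(_ _)/notF; exists [:: f.@[a]]; last by rewrite big_seq1.
by move=> v; rewrite inE => /eqP ->; exists a.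
Qed.
End FiniteValues.

(* Hensel lifting of a square root of X - gam, one factor of Q at a time. *)
Lemma sqrt_modulo (R : rcfType) (ws : seq R) (gam : R) : (forall w, w \in ws -> gam < w) ->
  exists s u : {poly R}, [/\ (size s <= (size ws).+2)%N, (size u <= (size ws).+2)%N &
    s ^+ 2 = 'X - gam%:P + u * \prod_(w <- ws) ('X - w%:P)].
Proof.
elim: ws => [_|w ws IH lt].
  exists 0, (- ('X - gam%:P)); rewrite big_nil size_poly0 size_polyN size_XsubC; split => //.
  by ring.
have [|s [u [ss su e]]] := IH; first by move=> v vw; apply: lt; rewrite inE vw orbT.
set Q := \prod_(w <- ws) ('X - w%:P) in e.
have sQ : size Q = (size ws).+1 by rewrite size_prod_XsubC.
have gw : gam < w by apply: lt; rewrite mem_head.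
(* This polynomial is the cofactor of Q in (s + c Q)^2 - (X - gam). If Q(w) is nonzero, c is chosen
   so that s + c Q takes the value sqrt(w - gam) at w; for a repeated w the equation is linear in c,
   with s(w)^2 = w - gam > 0. *)
have [c rc] : exists c, root (u + (2 * c) *: s + (c ^+ 2) *: Q) w.
  have ew := congr1 (fun p => p.[w]) e.
  rewrite /= horner_exp hornerD hornerM hornerXsubC in ew.
  have [Q0|Qn0] := eqVneq Q.[w] 0.
    have sw0 : s.[w] != 0.
      apply: contraTneq gw => s0; rewrite -leNgt -subr_le0.
      by move: ew; rewrite s0 Q0 mulr0 addr0 expr0n => <-.
    exists (- u.[w] / (2 * s.[w])); rewrite /root !hornerD !hornerZ Q0 mulr0 addr0.
    by apply/eqP; field.
  exists ((Num.sqrt (w - gam) - s.[w]) / Q.[w]); rewrite /root !hornerD !hornerZ.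
  have sq : Num.sqrt (w - gam) ^+ 2 = w - gam by rewrite sqr_sqrtr // subr_ge0 ltW.
  apply/eqP; apply: (mulfI Qn0); rewrite mulr0.
  have -> : Q.[w] * (u.[w] + 2 * ((Num.sqrt (w - gam) - s.[w]) / Q.[w]) * s.[w] +
      ((Num.sqrt (w - gam) - s.[w]) / Q.[w]) ^+ 2 * Q.[w]) =
      Num.sqrt (w - gam) ^+ 2 - s.[w] ^+ 2 + u.[w] * Q.[w] by field.
  by rewrite sq ew; ring.
have /factor_theorem[u' eu'] := rc.
have sz : (size (u + (2 * c) *: s + c ^+ 2 *: Q)%R <= (size ws).+2)%N.
  rewrite (leq_trans (size_polyD _ _)) // geq_max (leq_trans (size_polyD _ _)) ?geq_max.
    by rewrite (leq_trans (size_scale_leq _ _)) // sQ.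
  by rewrite su (leq_trans (size_scale_leq _ _)).
exists (s + c *: Q), u'; split.
- rewrite /= (leq_trans (size_polyD _ _)) // geq_max leqW //.
  by rewrite (leq_trans (size_scale_leq _ _)) // sQ; lia.
- have [->|u0] := eqVneq u' 0; first by rewrite size_poly0.
  by move: sz; rewrite eu' size_Mmonic ?monicXsubC // size_XsubC /=; lia.
- rewrite big_cons mulrA -/Q -eu' -!mul_polyC sqrrD e polyCM rmorphXn /=.
  rewrite -mulr_natl polyC_natr; ring.
Qed.

Lemma msize_horner_bound (R : realType) n (f : {mpoly R[n]}) B :
  exists E, forall s : {poly R}, (size s <= B)%N -> (msize (evalp (@mpolyC n R) f s) <= E)%N.
Proof.
exists (\max_(i < B) msize (f ^+ i)) => s sB.
rewrite evalpE (horner_coef_wide _ (leq_trans (size_poly _ _) sB)).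
apply: (leq_trans (mmeasure_sum _ _ _ _)); apply/bigmax_leqP => i _.
rewrite coef_map mul_mpolyC; apply: (leq_trans (msizeZ_le _ _)).
exact: (leq_bigmax (F := fun i : 'I_B => msize (f ^+ i))).
Qed.

(** With u = u2^2 - u1^2, f - gam becomes s(f)^2 + (u1(f) H)^2 + u2(f)^2 (- H^2). Only coefficients
    of s, u1, u2 depend on gam. *)
Lemma uniform_certificate (R : realType) n (f : {mpoly R[n]}) (h g : seq {mpoly R[n]}) (vs : seq R) :
  precone h g (- (\prod_(v <- vs) (f - v%:MP)) ^+ 2) ->
  exists D, forall gam, (forall v, v \in vs -> gam < v) -> certificate h g D (f - gam%:MP).
Proof.
set H := \prod_(v <- vs) _; move=> [D0 cD0].
have [E hE] := msize_horner_bound f (size (vs ++ vs)).+3.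
exists (E + E + D0 + (E + msize H))%N => gam lt.
(* Each value is taken twice because the certified element is - H^2, not - H. *)
have [|s [u [ss su e]]] := @sqrt_modulo R (vs ++ vs) gam.
  by move=> v; rewrite mem_cat => /orP[]; apply: lt.
pose sg := evalp (@mpolyC n R) f.
have sgX v : sg ('X - v%:P) = f - v%:MP.
  by rewrite /sg evalpE rmorphB /= map_polyX map_polyC hornerD hornerN hornerX hornerC.
have sgQ : sg (\prod_(w <- vs ++ vs) ('X - w%:P)) = H ^+ 2.
  rewrite rmorph_prod big_cat /= -expr2; congr (_ ^+ 2).
  by apply: eq_bigr => v _; apply: sgX.
pose u1 := (2%:R^-1)%:P * (u - 1); pose u2 := (2%:R^-1)%:P * (u + 1).
have eu : u = u2 ^+ 2 - u1 ^+ 2.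
  rewrite /u1 /u2 !exprMn -mulrBr -polyC_exp.
  have -> : (u + 1) ^+ 2 - (u - 1) ^+ 2 = 4%:R%:P * u by rewrite polyC_natr; ring.
  have e4 : 2%:R^-1 ^+ 2 * 4%:R = 1 :> R by field.
  by rewrite mulrA -polyCM e4 mul1r.
have -> : f - gam%:MP = sg s ^+ 2 + (sg u1 * H) ^+ 2 + sg u2 ^+ 2 * (- H ^+ 2).
  have := congr1 sg e; rewrite rmorphXn rmorphD rmorphM sgX sgQ {1}eu rmorphB !rmorphXn => ->.
  by ring.
have szu c : (size ((2%:R^-1)%:P * (u + c%:P))%R <= (size (vs ++ vs)).+3)%N.
  rewrite mul_polyC (leq_trans (size_scale_leq _ _)) // (leq_trans (size_polyD _ _)) //.
  by rewrite geq_max leqW // (leq_trans (size_polyC_leq1 _)).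
have hs1 : (msize (sg s) <= E)%N by apply: hE; apply: leqW.
have hs2 : (msize (sg u1) <= E)%N by apply: hE; have := szu (-1); rewrite rmorphN.
have hs3 : (msize (sg u2) <= E)%N by apply: hE; have := szu 1.
apply: certificateD; first apply: certificateD.
- apply: certificate_mono (certificate_sq _ _ _); move: hs1.
  by move: (msize (sg s)) (msize H) => m1 m2; lia.
- apply: certificate_mono (certificate_sq _ _ _); apply: (leq_trans (msizeM_leq _ _)); move: hs2.
  by move: (msize (sg u1)) (msize H) => m1 m2; lia.
- apply: certificate_mono (certificate_sqM _ cD0); move: hs3.
  by move: (msize (sg u2)) (msize H) => m1 m2; lia.
Qed.

(** * Moment relaxations *)

Lemma big_msupp_sub (R : nzRingType) n (p : {mpoly R[n]}) (s : seq 'X_{1..n}) (Y : 'X_{1..n} -> R) :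
  uniq s -> {subset msupp p <= s} ->
  \sum_(a <- msupp p) p@_a * Y a = \sum_(a <- s) p@_a * Y a.
Proof.
move=> us sub; rewrite [RHS](bigID (mem (msupp p))) /= [X in _ + X]big1 ?addr0; last first.
  by move=> a /memN_msupp_eq0 ->; rewrite mul0r.
rewrite -[RHS]big_filter; apply: perm_big; apply: uniq_perm; rewrite ?filter_uniq ?msupp_uniq //.
by move=> a; rewrite mem_filter /=; case: (boolP (a \in msupp p)) => // /sub ->.
Qed.

Section Moments.
Variables (R : realType) (n k : nat) (y : 'X_{1..n} -> R).
Implicit Types p q : {mpoly R[n]}.

Lemma riesz_linear c p q : riesz k y (c *: p + q) = c * riesz k y p + riesz k y q.
Proof.
pose Y a := if (mdeg a <= 2 * k)%N then y a else 0.
have E r : riesz k y r = \sum_(a <- msupp r) r@_a * Y a.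
  rewrite /riesz big_mkcond; apply: eq_bigr => a _; rewrite /Y.
  by case: ifP => //; rewrite mulr0.
pose s := undup (msupp (c *: p + q) ++ msupp p ++ msupp q).
have us : uniq s by exact: undup_uniq.
rewrite !E !(big_msupp_sub _ us); last first.
- by move=> a ap; rewrite mem_undup !mem_cat ap.
- by move=> a ap; rewrite mem_undup !mem_cat ap orbT.
- by move=> a ap; rewrite mem_undup !mem_cat ap !orbT.
rewrite mulr_sumr -big_split; apply: eq_bigr => a _ /=.
by rewrite mcoeffD mcoeffZ; ring.
Qed.

Lemma rieszD p q : riesz k y (p + q) = riesz k y p + riesz k y q.
Proof. by have := riesz_linear 1 p q; rewrite scale1r mul1r. Qed.

Lemma riesz0 : riesz k y 0 = 0.
Proof. by rewrite /riesz msupp0 big_nil. Qed.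

Lemma rieszZ c p : riesz k y (c *: p) = c * riesz k y p.
Proof. by have := riesz_linear c p 0; rewrite riesz0 !addr0. Qed.

Lemma riesz_sum (I : Type) (s : seq I) (P : pred I) (F : I -> {mpoly R[n]}) :
  riesz k y (\sum_(i <- s | P i) F i) = \sum_(i <- s | P i) riesz k y (F i).
Proof. exact: (big_morph _ rieszD riesz0). Qed.

Lemma riesz_ideal h a : locmat k h y = 0 -> (msize a <= locbound k h)%N ->
  riesz k y (h * a) = 0.
Proof.
move=> h0 sa; rewrite (mpolywE sa) mulr_sumr riesz_sum big1 // => m _.
rewrite -scalerAr rieszZ.
(* The values needed are the entries in the column of the monomial 1, which exists because the index
   [m] shows the matrix to be nonempty. *)
have b0 : (mdeg (0%MM : 'X_{1..n}) < locbound k h)%N.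
  by rewrite mdeg0; apply: leq_ltn_trans (bmdeg m).
have := congr1 (fun M : 'M_#|_| => M (enum_rank m) (enum_rank (BMultinom b0))) h0.
by rewrite !mxE !enum_rankK /= mpolyX0 mulr1 => ->; rewrite mulr0.
Qed.

Lemma riesz_sq g q : psd (locmat k g y) -> (msize q <= locbound k g)%N ->
  0 <= riesz k y (g * q ^+ 2).
Proof.
move=> hp sq; pose v : 'cV[R]_(#|{: 'X_{1..n < locbound k g}}|) := \col_i q@_(bmnm (enum_val i)).
have := hp v; suff -> : (v^T *m locmat k g y *m v) ord0 ord0 = riesz k y (g * q ^+ 2) by [].
have eq : q = \sum_(i < #|{: 'X_{1..n < locbound k g}}|) q@_(bmnm (enum_val i)) *: 'X_[bmnm (enum_val i)].
  rewrite {1}(mpolywE sq) (reindex (fun i : 'I_#|{: 'X_{1..n < locbound k g}}| => enum_val i)) //=.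
  by exists enum_rank => i _; rewrite ?enum_valK ?enum_rankK.
rewrite mxE; under eq_bigr => j _ do rewrite mxE mulr_suml.
rewrite exchange_big expr2 [X in riesz _ _ (_ * (X * _))]eq mulr_suml mulr_sumr riesz_sum.
apply: eq_bigr => i _ /=; rewrite -scalerAl -scalerAr rieszZ.
rewrite [X in riesz _ _ (_ * (_ * X))]eq ['X_[_] * _]mulr_sumr [g * _]mulr_sumr riesz_sum mulr_sumr.
apply: eq_bigr => j _; rewrite !mxE -!scalerAr rieszZ.
by rewrite [g * ('X_[_] * _)]mulrA; ring.
Qed.

Lemma riesz_cert (h g : seq {mpoly R[n]}) D p :
  (forall q, q \in h -> locmat k q y = 0) ->
  (forall r : {set 'I_(size g)}, psd (locmat k (gpow r) y)) ->
  (forall q, q \in h -> (D <= locbound k q)%N) ->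
  (forall r : {set 'I_(size g)}, (D <= locbound k (gpow r))%N) ->
  certificate h g D p -> 0 <= riesz k y p.
Proof.
move=> h0 gp hb gb [a [s [h1 h2 ->]]]; rewrite rieszD !riesz_sum.
rewrite big1 ?add0r => [|i _]; last first.
  apply: riesz_ideal; first by apply: h0; apply: mem_nth.
  by apply: leq_trans (hb _ _); [exact: h1|exact: mem_nth].
apply: sumr_ge0 => r _; rewrite mulr_sumr riesz_sum big_seq; apply: sumr_ge0 => q qs.
by apply: riesz_sq => //; apply: leq_trans (gb r); apply: h2 qs.
Qed.
End Moments.

Section PointMoments.
Variables (R : realType) (n k : nat) (x : 'I_n -> R).
Implicit Types p q : {mpoly R[n]}.
Let y (m : 'X_{1..n}) : R := \prod_i x i ^+ m i.

Lemma riesz_point p : (msize p <= (2 * k).+1)%N -> riesz k y p = p.@[x].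
Proof.
move=> sp; rewrite mevalE /riesz big_seq_cond [RHS]big_seq_cond; apply: eq_bigl => m.
case: (boolP (m \in msupp p)) => //= /msize_mdeg_lt lt.
by rewrite -ltnS (leq_trans lt).
Qed.

(** [y] lists the moments of the Dirac measure at [x], so the localizing matrix has rank at most
    one; [locbound] keeps all products within degree 2k. *)
Lemma locmat_point q : locmat k q y =
  q.@[x] *: (\col_(i < #|{: 'X_{1..n < locbound k q}}|) 'X_[bmnm (enum_val i)].@[x] *m
             (\col_(i < #|{: 'X_{1..n < locbound k q}}|) 'X_[bmnm (enum_val i)].@[x])^T).
Proof.
apply/matrixP => i j; rewrite !mxE big_ord1 !mxE riesz_point ?mevalM ?mulrA //.
have hi := bmdeg (enum_val i); have hj := bmdeg (enum_val j).
have s1 := msizeM_leq (q * 'X_[bmnm (enum_val i)]) 'X_[bmnm (enum_val j)].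
have s2 := msizeM_leq q 'X_[bmnm (enum_val i)].
rewrite !msizeX in s1 s2; apply: (leq_trans s1); move: hi hj s2.
move: (mdeg (bmnm (enum_val i))) (mdeg (bmnm (enum_val j))) (msize (q * _)) => a b d.
by rewrite /locbound /pdeg; move: (msize q) => c; case: ifP; lia.
Qed.

Lemma psd_point q : 0 <= q.@[x] -> psd (locmat k q y).
Proof.
move=> q0 v; rewrite locmat_point -scalemxAr -scalemxAl mxE mulr_ge0 //.
set c := \col_i _; rewrite mulmxA -(mulmxA (v^T *m c)).
have -> : c^T *m v = (v^T *m c)^T by rewrite trmx_mul trmxK.
by rewrite mxE big_ord1 [X in _ * X]mxE -expr2 sqr_ge0.
Qed.

Lemma locmat_point0 q : q.@[x] = 0 -> locmat k q y = 0.
Proof. by move=> q0; rewrite locmat_point q0 scale0r. Qed.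
End PointMoments.

(** Certificates exist only strictly below the optimal value; this passes to the limit, for finite
    and infinite values alike. *)
Lemma le_of_lower_reals (R : realType) (v w : \bar R) :
  (forall t : R, (t%:E < v)%E -> (t%:E <= w)%E) -> (v <= w)%E.
Proof.
case: v => [r||] hv; last by rewrite leNye.
- case: w hv => [t||] hv; [|by rewrite leey|].
  + rewrite lee_fin leNgt; apply/negP => tr.
    have := hv ((t + r) / 2); rewrite lte_fin lee_fin.
    have mr : (t + r) / 2 < r by clear hv; lra.
    by rewrite mr => /(_ isT) {hv}; lra.
  + by have := hv (r - 1); rewrite lte_fin gtrBl ltr01 => /(_ isT).
- case: w hv => [t||] hv //.
  + by have := hv (t + 1); rewrite ltry lee_fin => /(_ isT); rewrite gerDl ler10.
  + by have := hv 0; rewrite ltry => /(_ isT).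
Qed.

Section PartOne.
Variables (R : realType) (n me mi : nat) (f : {mpoly R[n]})
  (ceq p_eq : 'I_me -> {mpoly R[n]}) (cin p_in : 'I_mi -> {mpoly R[n]}).
Local Notation hs := (ceq_s ceq ++ phi f ceq cin p_eq p_in).
Local Notation gs := (gtuple cin p_in).

Lemma feasible_c_hs x q : feasible_c f ceq cin p_eq p_in x -> q \in hs -> q.@[x] = 0.
Proof.
move=> [[h1 _] [h2 _]]; rewrite mem_cat => /orP[/mapP[i _ ->]|]; first exact: h1.
exact: h2.
Qed.

Lemma feasible_c_gs x q : feasible_c f ceq cin p_eq p_in x -> q \in gs -> 0 <= q.@[x].
Proof.
move=> [[_ h1] [_ h2]]; rewrite mem_cat => /orP[/mapP[i _ ->]|]; first exact: h1.
exact: h2.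
Qed.

Lemma feasible_c_gpow x (r : {set 'I_(size gs)}) :
  feasible_c f ceq cin p_eq p_in x -> 0 <= (gpow r).@[x].
Proof.
move=> hx; rewrite /gpow rmorph_prod; apply: prodr_ge0 => i _.
by apply: (feasible_c_gs hx); apply: mem_nth.
Qed.

Lemma sos_vals_le k gam x : sos_vals f ceq cin p_eq p_in k gam ->
  feasible_c f ceq cin p_eq p_in x -> gam <= f.@[x].
Proof.
move=> [p1 [p2 [[a [_ e1]] [[s [hs' e2]] e]]]] hx; rewrite -subr_ge0.
have -> : f.@[x] - gam = (p1 + p2).@[x] by rewrite -e mevalB mevalC.
rewrite mevalD e1 e2 !rmorph_sum big1 ?add0r => [|i _]; last first.
  by rewrite rmorphM /= (feasible_c_hs hx) ?mul0r //; apply: mem_nth.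
apply: sumr_ge0 => r _; rewrite rmorphM /= mulr_ge0 ?feasible_c_gpow //.
have [[t ->] _] := hs' r; rewrite rmorph_sum; apply: sumr_ge0 => q _.
by rewrite rmorphXn sqr_ge0.
Qed.

Lemma cert_degree_bound D : exists k0, forall k, (k0 <= k)%N ->
  [/\ forall q, q \in hs -> (D <= locbound k q)%N /\ (D + pdeg q <= 2 * k)%N,
      forall r : {set 'I_(size gs)}, (D <= locbound k (gpow r))%N /\ (2 * D + pdeg (gpow r) <= 2 * k)%N &
      (msize f <= (2 * k).+1)%N].
Proof.
pose B := (\max_(q <- hs) pdeg q + \max_(r : {set 'I_(size gs)}) pdeg (gpow r))%N.
exists (B + D + msize f).+1 => k le.
have lb q : (pdeg q <= B)%N -> (D <= locbound k q)%N.
  rewrite /locbound; move: (pdeg q) (msize f) le => a b le qB.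
  have u : (uphalf a <= k)%N by move: (B) le qB => c; lia.
  by rewrite u; move: (B) le qB => c; lia.
split.
- move=> q qh; have qB : (pdeg q <= B)%N.
    rewrite /B; apply: leq_trans (leq_addr _ _).
    exact: leq_bigmax_seq.
  split; first exact: lb.
  by move: (pdeg q) (msize f) (B) le qB => a b c; lia.
- move=> r; have rB : (pdeg (gpow r) <= B)%N.
    rewrite /B; apply: leq_trans (leq_addl _ _).
    exact: (leq_bigmax (F := fun r : {set 'I_(size gs)} => pdeg (gpow r))).
  split; first exact: lb.
  by move: (pdeg (gpow r)) (msize f) (B) le rB => a b c; lia.
- by move: (msize f) (B) le => b c; lia.
Qed.

Lemma cert_sos_vals D k gam :
  (forall q, q \in hs -> (D + pdeg q <= 2 * k)%N) ->
  (forall r : {set 'I_(size gs)}, (2 * D + pdeg (gpow r) <= 2 * k)%N) ->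
  certificate hs gs D (f - gam%:MP) -> sos_vals f ceq cin p_eq p_in k gam.
Proof.
move=> hb gb [a [s [h1 h2 e]]]; eexists; eexists; split; last split; last exact: e.
  exists a; split => // i; right.
  have := hb hs`_i (mem_nth _ (ltn_ord i)); have := h1 i; rewrite [pdeg (a i)]/pdeg.
  by move: (pdeg _) (msize (a i)) => x y; lia.
exists (fun r => \sum_(q <- s r) q ^+ 2); split => // r; split; first by exists (s r).
right; have sz : (msize (\sum_(q <- s r) q ^+ 2) <= (2 * D).+1)%N.
  apply: (leq_trans (mmeasure_sum _ _ _ _)); apply/bigmax_leqP_seq => q qs _.
  have := msizeM_leq q q; have := h2 r q qs; rewrite -expr2.
  by move: (msize q) (msize (q ^+ 2)) => x y; lia.
have := gb r; rewrite [pdeg (\sum_(q <- s r) _)]/pdeg.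
by move: (pdeg _) (msize _) sz => x y; lia.
Qed.

(** The same certificate of f - gam gives a feasible gam on the sum-of-squares side and, applied to
    a moment vector, a lower bound on the moment side. The opposite bounds come from evaluating at
    feasible points and from their Dirac moments. *)
Lemma tight_relaxation (fc : \bar R) : is_einf (fc_vals f ceq cin p_eq p_in) fc ->
  exists k0 : nat, forall k : nat, (k0 <= k)%N ->
    is_esup (sos_vals f ceq cin p_eq p_in k) fc /\ is_einf (mom_vals f ceq cin p_eq p_in k) fc.
Proof.
move=> [fc1 fc2].
have [vs hvs cert] := critical_values_certificate f ceq p_eq cin p_in.
have [D hD] := uniform_certificate cert.
have certD gam : (gam%:E < fc)%E -> certificate hs gs D (f - gam%:MP).
  by move=> lt; apply: hD => v /hvs/fc1 le; have := lt_le_trans lt le; rewrite lte_fin.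
have [k0 hk0] := cert_degree_bound D.
exists k0 => k /hk0[bh bg bf]; split; split.
- move=> s ss; apply: fc2 => _ [x [hx ->]]; rewrite lee_fin.
  exact: sos_vals_le ss hx.
- move=> w hw; apply: le_of_lower_reals => gam lt; apply: hw.
  apply: (cert_sos_vals _ _ (certD _ lt)) => [q /bh[]//|r].
  by have [] := bg r.
- move=> _ [y [y1 [y2 [y3 [y4 ->]]]]]; apply: le_of_lower_reals => gam lt.
  rewrite lee_fin -subr_ge0.
  have -> : riesz k y f - gam = riesz k y (f - gam%:MP).
    have -> : f - gam%:MP = (- gam) *: 1 + f by rewrite -mul_mpolyC mulr1 mpolyCN addrC.
    by rewrite riesz_linear y1 mulr1 addrC.
  apply: (@riesz_cert _ _ _ _ hs gs D) => //.
  + by move=> q; rewrite mem_cat => /orP[/y2|/y3].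
  + by move=> q /bh[].
  + by move=> r; have [] := bg r.
  + exact: certD.
- move=> w hw; apply: fc2 => v [x [hx ev]]; apply: hw.
  exists (fun m => \prod_i x i ^+ m i); rewrite !riesz_point ?msize1 // rmorph1.
  split => //; split; last split; last split => //.
  + move=> q qh; apply: locmat_point0; apply: (feasible_c_hs hx).
    by rewrite mem_cat qh.
  + move=> q qh; apply: locmat_point0; apply: (feasible_c_hs hx).
    by rewrite mem_cat qh orbT.
  + by move=> r; apply: psd_point; apply: feasible_c_gpow.
Qed.
End PartOne.

(** * Signs of the multipliers *)

Section Curve.
Variables (R : comNzRingType) (n : nat).
Implicit Types (q : {mpoly R[n]}) (X d : 'I_n -> {poly R}) (h : {poly R}).

Definition along X : {rmorphism {mpoly R[n]} -> {poly R}} := mmap (@polyC R) X.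

Lemma alongC X c : along X c%:MP = c%:P.
Proof. exact: mmapC. Qed.
Lemma alongX X l : along X 'X_l = X l.
Proof. by rewrite /along /= mmapX mmap1U. Qed.

(** The increment [h] is left free: Newton's iteration takes a power of X, the first-order expansion
    of the objective takes X itself. *)
Lemma along_taylor X d h q : exists r,
  along (fun l => X l + h * d l) q =
  along X q + h * (\sum_(l < n) along X q^`M(l) * d l) + h ^+ 2 * r.
Proof.
elim/mpoly_ring_ind: q.
- move=> c; exists 0; rewrite !alongC big1 ?mulr0 ?addr0 // => l _.
  by rewrite mderivC rmorph0 mul0r.
- move=> k; exists 0; rewrite !alongX mulr0 addr0 (bigD1 k) //= big1 ?addr0 => [|l lk].
    by rewrite mderivXU eqxx rmorph1 mul1r.
  by rewrite mderivXU eq_sym (negPf lk) rmorph0 mul0r.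
- move=> p q [r er] [s es]; exists (r + s); rewrite !rmorphD /= er es.
  under [in RHS]eq_bigr => l _ do rewrite mderivD rmorphD mulrDl.
  by rewrite big_split /=; ring.
- move=> p q [r er] [s es].
  set SP := \sum_(l < n) _ in er; set SQ := \sum_(l < n) _ in es.
  exists (SP * SQ + along X p * s + along X q * r + h * (SP * s + SQ * r) + h ^+ 2 * (r * s)).
  have -> : \sum_(l < n) along X (p * q)^`M(l) * d l = along X q * SP + along X p * SQ.
    rewrite !mulr_sumr -big_split; apply: eq_bigr => l _ /=.
    by rewrite mderivM rmorphD !rmorphM /=; ring.
  by rewrite !rmorphM /= er es; ring.
Qed.

Lemma along_horner0 X u q : (forall l, (X l).[0] = u l) -> (along X q).[0] = q.@[u].
Proof.
move=> hX; apply: (@mpoly_morph_ext _ _ _ (horner_eval 0 \o along X : {rmorphism {mpoly R[n]} -> R}) (meval u)).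
  by move=> c; rewrite /= alongC /horner_eval hornerC mevalC.
by move=> l; rewrite /= alongX /horner_eval hX mevalXU.
Qed.
End Curve.

Section NewtonCurve.
Variables (R : fieldType) (n m : nat) (cc : 'I_m -> {mpoly R[n]}) (u : 'I_n -> R) (act : pred 'I_m)
  (nv : 'I_m -> 'I_n -> R) (b : 'I_m -> {poly R}).
Hypotheses (cu : forall k, act k -> (cc k).@[u] = 0)
  (dual : forall k i, act k -> \sum_(l < n) (cc k)^`M(l).@[u] * nv i l = (k == i)%:R)
  (b0 : forall k, (b k).[0] = 0).

(** [nv] is a right inverse of the Jacobian of the active constraints at [u], so a correction of
    order N + 1 cancels the lowest error coefficient of all of them at once. *)
Lemma newton_curve N : exists2 X : 'I_n -> {poly R}, forall l, (X l).[0] = u l &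
  forall k, act k -> 'X^(N.+1) %| along X (cc k) - b k.
Proof.
elim: N => [|N [X X0 hX]].
  exists (fun l => (u l)%:P) => [l|k ak]; first by rewrite hornerC.
  rewrite expr1 -['X]subr0 -polyC0 dvdp_XsubCl /root hornerD hornerN b0 subr0.
  by rewrite (along_horner0 (u := u)) ?cu // => l; rewrite hornerC.
pose e k := (along X (cc k) - b k) %/ 'X^(N.+1).
have ek k : act k -> along X (cc k) - b k = 'X^(N.+1) * e k.
  by move=> ak; rewrite mulrC divpK //; apply: hX.
pose dl l : {poly R} := - (\sum_(i < m | act i) (e i).[0] * nv i l)%:P.
exists (fun l => X l + 'X^(N.+1) * dl l) => [l|k ak].
  by rewrite hornerD hornerM hornerXn expr0n mul0r addr0.
have [r ->] := along_taylor X dl 'X^(N.+1) (cc k).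
set S := \sum_(l < n) _.
have -> : along X (cc k) + 'X^(N.+1) * S + 'X^(N.+1) ^+ 2 * r - b k =
    'X^(N.+1) * (e k + S) + 'X^(N.+1) ^+ 2 * r.
  by rewrite mulrDr -(ek _ ak); ring.
rewrite dvdp_add //; last first.
  by rewrite dvdp_mulr // -exprM dvdp_exp2l //; lia.
rewrite exprSr dvdp_mul // -['X]subr0 -polyC0 dvdp_XsubCl /root hornerD.
rewrite horner_sum; under eq_bigr => l _.
  rewrite hornerM (along_horner0 (u := u)) // hornerN hornerC mulrN mulr_sumr.
  under eq_bigr => i _ do rewrite mulrCA.
  over.
rewrite sumrN exchange_big /=.
under eq_bigr => i _ do rewrite -mulr_sumr dual //.
rewrite (bigD1 k) //= eqxx mulr1 big1 ?addr0 ?subrr // => i /andP[_ ik].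
by rewrite eq_sym (negPf ik) mulr0.
Qed.
End NewtonCurve.

(** * Signs of lowest coefficients along truncated curves *)

Section LowestCoefficient.
Variables (R : realFieldType) (N : nat).
Implicit Types p q : {poly R}.

(** Nonnegativity in R[[t]] ordered with t a positive infinitesimal, observed only below order
    [N]. *)
Definition lowpos p := forall m, (m < N)%N -> (forall i, (i < m)%N -> p`_i = 0) -> 0 <= p`_m.

Lemma lowposD p q : lowpos p -> lowpos q -> lowpos (p + q).
Proof.
move=> hp hq m mN z.
have pq i : (i < m)%N -> p`_i = 0 /\ q`_i = 0.
  elim/ltn_ind: i => i IH im.
  have zi := z i im; rewrite coefD in zi.
  have p0 : 0 <= p`_i by apply: hp => [|j ji]; [exact: ltn_trans mN|case: (IH j ji (ltn_trans ji im))].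
  have q0 : 0 <= q`_i by apply: hq => [|j ji]; [exact: ltn_trans mN|case: (IH j ji (ltn_trans ji im))].
  by split; lra.
by rewrite coefD addr_ge0 //; [apply: hp|apply: hq] => // i /pq[].
Qed.

Lemma poly_valuation p : p != 0 -> exists a p', p = p' * 'X^a /\ p'`_0 != 0.
Proof.
move=> p0; have [a [p' + e]] := multiplicity_XsubC p 0; rewrite p0 subr0 in e * => /=.
by rewrite /root horner_coef0 => h; exists a, p'.
Qed.

Lemma lowposM p q : lowpos p -> lowpos q -> lowpos (p * q).
Proof.
move=> hp hq m mN; have [->|/poly_valuation[a [p' [ep p'0]]]] := eqVneq p 0.
  by rewrite mul0r coef0.
have [->|/poly_valuation[c [q' [eq q'0]]]] := eqVneq q 0; first by rewrite mulr0 coef0.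
have epq : p * q = (p' * q') * 'X^(a + c) by rewrite ep eq exprD; ring.
rewrite epq => z; rewrite coefMXn; case: ltnP => // le.
have pq0 : (p' * q')`_0 = p'`_0 * q'`_0 by rewrite coef0M.
have e : m = (a + c)%N.
  apply/eqP; rewrite eqn_leq le andbT leqNgt; apply/negP => lt.
  have := z _ lt; rewrite coefMXn ltnn subnn pq0 => /eqP.
  by rewrite mulf_eq0 (negPf p'0) (negPf q'0).
rewrite e subnn pq0 mulr_ge0 //.
  have := hp a; rewrite ep coefMXn ltnn subnn; apply; first by lia.
  by move=> i ia; rewrite coefMXn ia.
have := hq c; rewrite eq coefMXn ltnn subnn; apply; first by lia.
by move=> i ia; rewrite coefMXn ia.
Qed.

Lemma lowpos_sqr p : lowpos (p ^+ 2).
Proof.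
move=> m mN; have [->|/poly_valuation[a [p' [ep p'0]]]] := eqVneq p 0.
  by rewrite expr0n coef0.
have e2 : p ^+ 2 = p' ^+ 2 * 'X^(a + a) by rewrite ep exprD; ring.
rewrite e2 => z; rewrite coefMXn; case: ltnP => // le.
have pq0 : (p' ^+ 2)`_0 = p'`_0 ^+ 2 by rewrite expr2 coef0M.
have -> : m = (a + a)%N.
  apply/eqP; rewrite eqn_leq le andbT leqNgt; apply/negP => lt.
  have := z _ lt; rewrite coefMXn ltnn subnn pq0 => /eqP.
  by rewrite expf_eq0 (negPf p'0).
by rewrite subnn pq0 sqr_ge0.
Qed.

Lemma lowpos_dvd p : 'X^N %| p -> lowpos p.
Proof. by move=> /dvdpP[q ->] m mN _; rewrite coefMXn mN. Qed.

Lemma lowpos0 : lowpos 0.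
Proof. by move=> m _ _; rewrite coef0. Qed.

Lemma lowpos1 : lowpos 1.
Proof. by move=> [|m] _ _; rewrite coef1 ?ler01. Qed.
End LowestCoefficient.

Lemma precone_lowpos (R : realType) n (h g : seq {mpoly R[n]}) (X : 'I_n -> {poly R}) N p :
  (forall q, q \in h -> 'X^N %| along X q) -> (forall q, q \in g -> lowpos N (along X q)) ->
  precone h g p -> lowpos N (along X p).
Proof.
move=> hh hg [D [a [s [_ _ ->]]]]; rewrite rmorphD !rmorph_sum /=; apply: lowposD.
  apply: lowpos_dvd; apply: (big_ind (fun p => 'X^N %| p)).
  - exact: dvdp0.
  - by move=> x y; apply: dvdp_add.
  by move=> i _; rewrite rmorphM dvdp_mulr // hh //; apply: mem_nth.
apply: (big_ind (lowpos N)); [exact: lowpos0|exact: lowposD|move=> r _].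
rewrite rmorphM; apply: lowposM.
  rewrite /gpow rmorph_prod; apply: (big_ind (lowpos N)); [exact: lowpos1|exact: lowposM|].
  by move=> i _; apply: hg; apply: mem_nth.
rewrite rmorph_sum; apply: (big_ind (lowpos N)); [exact: lowpos0|exact: lowposD|].
by move=> q _; rewrite rmorphXn; apply: lowpos_sqr.
Qed.

Section Multipliers.
Variables (R : realType) (n me mi : nat) (f : {mpoly R[n]})
  (ceq p_eq : 'I_me -> {mpoly R[n]}) (cin p_in : 'I_mi -> {mpoly R[n]}).
Variables (u : 'I_n -> R) (lam_eq : 'I_me -> R) (lam_in : 'I_mi -> R).
Hypotheses (hA : assumptionA f ceq cin p_eq p_in) (crit : crit_pair f ceq cin u lam_eq lam_in).

Let cc (k : 'I_(me + mi)) := match split k with inl i => ceq i | inr j => cin j end.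
Let lam (k : 'I_(me + mi)) := match split k with inl i => lam_eq i | inr j => lam_in j end.

Let splitl i : split (lshift mi i) = inl i :> ('I_me + 'I_mi).
Proof. exact: (unsplitK (inl i)). Qed.
Let splitr i : split (rshift me i) = inr i :> ('I_me + 'I_mi).
Proof. exact: (unsplitK (inr i)). Qed.

Let gradf l : f^`M(l).@[u] = \sum_k lam k * (cc k)^`M(l).@[u].
Proof.
case: crit => _ [_ ->]; rewrite big_split_ord /=.
by congr (_ + _); apply: eq_bigr => i _; rewrite /lam /cc ?splitl ?splitr.
Qed.

(* Uniqueness of the multipliers makes the active gradients linearly independent. *)
Lemma active_gradients_dual : exists nv : 'I_(me + mi) -> 'I_n -> R,
  forall k i, (cc k).@[u] = 0 -> \sum_(l < n) (cc k)^`M(l).@[u] * nv i l = (k == i)%:R.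
Proof.
pose J : 'M[R]_(me + mi, n) := \matrix_(k, l) (cc k)^`M(l).@[u].
(* A row in the left kernel of [A] is exactly a change of multipliers that keeps the pair critical.
   On active rows the diagonal block vanishes, so a right inverse of [A] restricts to one of the
   Jacobian. *)
pose A := row_mx J (diag_mx (\row_k (cc k).@[u])).
have /row_freeP[B AB] : row_free A.
  apply: inj_row_free => mu; rewrite mul_mx_row -(row_mx0 _ _ n) => /eq_row_mx[m1 m2].
  have m1l l : \sum_k mu ord0 k * (cc k)^`M(l).@[u] = 0.
    by have /matrixP/(_ ord0 l) := m1; rewrite !mxE; under eq_bigr do rewrite mxE.
  have m2k k : mu ord0 k * (cc k).@[u] = 0.
    by have /matrixP/(_ ord0 k) := m2; rewrite mul_mx_diag !mxE.
  have c2 : crit_pair f ceq cin u (fun i => lam_eq i + mu ord0 (lshift mi i))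
      (fun j => lam_in j + mu ord0 (rshift me j)).
    case: crit => e1 [e2 e3]; split => //; split.
      move=> j; rewrite mulrDl e2 add0r; have := m2k (rshift me j).
      by rewrite /cc splitr.
    move=> l; have := m1l l; rewrite big_split_ord /= => e0.
    under eq_bigr do rewrite mulrDl; under [X in _ = _ + X]eq_bigr do rewrite mulrDl.
    rewrite !big_split /= addrACA -e3 -[LHS]addr0; congr (_ + _); apply: (etrans (esym e0)).
    by congr (_ + _); apply: eq_bigr => i _; rewrite /cc ?splitl ?splitr.
  have [a1 a2] := hA crit; have [b1 b2] := hA c2.
  apply/rowP => k; rewrite mxE; case: (split_ordP k) => i ->.
    by have := b1 i; rewrite -a1 => /eqP; rewrite -subr_eq0 addrAC subrr add0r => /eqP.
  by have := b2 i; rewrite -a2 => /eqP; rewrite -subr_eq0 addrAC subrr add0r => /eqP.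
exists (fun i l => B (lshift _ l) i) => k i ck.
have := congr1 (fun M : 'M_(_) => M k i) AB; rewrite /A !mxE big_split_ord /= => <-.
rewrite [X in _ = _ + X]big1 ?addr0; last first.
  by move=> j _; rewrite row_mxEr !mxE ck mul0rn mul0r.
by apply: eq_bigr => l _; rewrite row_mxEl mxE.
Qed.

Hypotheses (feas : feasible ceq cin u) (umin : forall x, feasible ceq cin x -> f.@[u] <= f.@[x]).

(* If some multiplier were negative, f would decrease along a formal curve that is
   feasible to arbitrarily high order; this contradicts the certificate that
   optimality of u provides. *)
Lemma multiplier_nneg j0 : 0 <= lam_in j0.
Proof.
rewrite leNgt; apply/negP => neg.
pose F := (f.@[u])%:MP - f.
pose h := ceq_s ceq; pose g := F :: cin_s cin.
pose M (p : {mpoly R[n]}) := exists e, p = F ^+ e.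
have [||[_ [e ->] cert]|[K [al [k1 k2 k3 k4]]]] := @certificate_or_point R n h g M.
- by exists 0%N; rewrite expr0.
- by move=> _ _ [a ->] [b ->]; exists (a + b)%N; rewrite exprD.
- have [nv dual] := active_gradients_dual.
  pose k0 : 'I_(me + mi) := rshift me j0.
  (* The curve enters the region c_j0 > 0 at unit speed and keeps every other active constraint at
     zero, so f starts with slope [lam_in j0]. *)
  pose b (k : 'I_(me + mi)) : {poly R} := if k == k0 then 'X else 0.
  pose act (k : 'I_(me + mi)) := (cc k).@[u] == 0.
  (* The curve is exact modulo X^(2e+2): the contradiction is at X^(2e), and for e = 0 the linear
     coefficients must still be right to compute that of [F]. *)
  have [|||X X0 hX] := @newton_curve R n _ cc u act nv b _ _ _ (e + e).+1.
  + by move=> k /eqP.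
  + by move=> k i /eqP; apply: dual.
  + by move=> k; rewrite /b; case: ifP; rewrite ?hornerX ?horner0.
  have [ceq0 [lc0 _]] := crit.
  have act0 : act k0.
    by have /eqP := lc0 j0; rewrite mulf_eq0 lt_eqF //= /act /cc splitr.
  have coefk k i : act k -> (i < (e + e).+2)%N -> (along X (cc k))`_i = (b k)`_i.
    move=> ak ie; have /dvdpP[q eq] := hX k ak.
    by have := congr1 (fun p : {poly R} => p`_i) eq; rewrite coefB coefMXn ie => /eqP; rewrite subr_eq0 => /eqP.
  have [F' eF F'0] : exists2 F', along X F = 'X * F' & 0 < F'`_0.
    have /choice[d hd] l : exists d, X l = (u l)%:P + 'X * d.
      have : root (X l - (u l)%:P) 0 by rewrite /root hornerD hornerN hornerC X0 subrr.
      move=> /factor_theorem[d]; rewrite subr0 => ed; exists d.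
      by rewrite mulrC -ed addrC subrK.
    have T q : exists r, along X q = (q.@[u])%:P +
        'X * (\sum_(l < n) (q^`M(l).@[u])%:P * d l) + 'X ^+ 2 * r.
      have [r er] := along_taylor (fun l => (u l)%:P) d 'X q; exists r.
      have alc p : along (fun l => (u l)%:P) p = (p.@[u])%:P.
        apply: (@mpoly_morph_ext _ _ _ (along (fun l => (u l)%:P))
          (@polyC R \o meval u : {rmorphism {mpoly R[n]} -> {poly R}})).
          by move=> c; rewrite alongC /= mevalC.
        by move=> l; rewrite alongX /= mevalXU.
      rewrite alc in er; rewrite -(eq_bigr _ (fun l _ => congr1 (fun t => t * d l) (alc _))) -er.
      by rewrite /along /=; congr (mmap _ _ _); apply/funext => l; apply: hd.
    have c1 q : (along X q)`_1 = \sum_(l < n) q^`M(l).@[u] * (d l)`_0.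
      have [r ->] := T q; rewrite !coefD coefC coefXM coefXnM /= add0r addr0 coef_sum.
      by apply: eq_bigr => l _; rewrite coefCM.
    have [r er] := T f.
    exists (- (\sum_(l < n) (f^`M(l).@[u])%:P * d l) - 'X * r).
      by rewrite /F rmorphB /= alongC er; ring.
    rewrite coefB coefXM subr0 coefN coef_sum oppr_gt0.
    suff -> : \sum_(l < n) ((f^`M(l).@[u])%:P * d l)`_0 = lam_in j0 by [].
    under eq_bigr => l _ do rewrite coefCM gradf mulr_suml.
    rewrite exchange_big /=.
    under eq_bigr => k _.
      under eq_bigr => l _ do rewrite -mulrA.
      rewrite -mulr_sumr -c1.
      over.
    rewrite (bigD1 k0) //= big1 ?addr0 => [|k kk0].
      rewrite coefk // /b eqxx coefX mulr1 /lam splitr //.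
    have [ak|nak] := boolP (act k); first by rewrite coefk // /b (negPf kk0) coef0 mulr0.
    suff -> : lam k = 0 by rewrite mul0r.
    move: nak; rewrite /act /cc /lam; case: (split k) => i; first by rewrite ceq0 eqxx.
    by have /eqP := lc0 i; rewrite mulf_eq0 => /orP[/eqP ->|->].
  have lp : lowpos (e + e).+1 (along X (- (F ^+ e) ^+ 2)).
    apply: precone_lowpos cert.
    + move=> q /mapP[i _ ->]; have := hX (lshift mi i).
      rewrite /act /cc splitl ceq0 eqxx /b.
      have -> : lshift mi i == k0 = false by apply/negP => /eqP/(congr1 val) /=; have := ltn_ord i; lia.
      move=> /(_ isT); rewrite subr0; apply: dvdp_trans.
      exact: dvdp_exp2l.
    + move=> q; rewrite inE => /predU1P[->|/mapP[j _ ->]].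
        move=> [|[|m]] _ z.
        * by rewrite eF coefXM.
        * by rewrite eF coefXM ltW.
        * have := z 1%N isT; rewrite eF coefXM /= => F0.
          by rewrite F0 ltxx in F'0.
      have ej : cin j = cc (rshift me j) by rewrite /cc splitr.
      have [ak|nak] := boolP (act (rshift me j)).
        move=> m mN _; rewrite ej coefk //; last exact: ltnW.
        rewrite /b; case: ifP => _; last by rewrite coef0.
        by rewrite coefX ler0n.
      have pos : 0 < (along X (cin j))`_0.
        rewrite -horner_coef0 (along_horner0 _ X0) lt_neqAle (proj2 feas) andbT eq_sym.
        by move: nak; rewrite /act -ej.
      move=> [|m] _ z; first exact: ltW.
      by have := z 0%N isT => e0; rewrite e0 ltxx in pos.
  (* [F] vanishes to order exactly one, so the certified element has a negative lowest coefficient,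
     at order 2e. *)
  have eL : along X (- (F ^+ e) ^+ 2) = - (F' ^+ (e + e)) * 'X^(e + e).
    by rewrite rmorphN !rmorphXn /= eF -exprM muln2 -addnn exprMn; ring.
  have := lp (e + e)%N (ltnSn _); rewrite eL coefMXn ltnn subnn coefN.
  have c0 k : (F' ^+ k)`_0 = F'`_0 ^+ k.
    by elim: k => [|k IH]; rewrite ?expr0 ?coef1 // !exprS coef0M IH.
  rewrite c0 oppr_ge0 leNgt exprn_gt0 // => H; suff : false by [].
  by apply: H => i ie; rewrite coefMXn ie.
(* In the other alternative [F] is nonnegative and nonzero in [K], hence positive; the real point is
   then feasible with f(a) < f(u). *)
have [a ha] := artin_lang k1 (h ++ g).
have fa : feasible ceq cin a.
  split=> [i|j].
    have ih : ceq i \in h by rewrite /h /ceq_s map_f // mem_enum.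
    have := ha (ceq i); rewrite mem_cat ih (k2 _ ih) sgz0 => /(_ isT)/eqP.
    by rewrite sgz_eq0 => /eqP.
  have ig : cin j \in g by rewrite inE /cin_s map_f ?orbT // mem_enum.
  have := ha (cin j); rewrite mem_cat ig orbT => /(_ isT)/sgz_ge0E ->.
  exact: k3.
have := umin fa; rewrite leNgt => /negP; apply.
have Fg : F \in g by rewrite mem_head.
have : 0 < F.@[a].
  have := ha F; rewrite mem_cat Fg orbT => /(_ isT)/sgz_gt0E ->.
  by rewrite lt_neqAle eq_sym k4 ?k3 //; exists 1%N.
by rewrite /F mevalB mevalC subr_gt0.
Qed.
End Multipliers.

Theorem theorem7p1 (R : realType) (n me mi : nat) (f : {mpoly R[n]})
  (ceq : 'I_me -> {mpoly R[n]}) (cin : 'I_mi -> {mpoly R[n]})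
  (p_eq : 'I_me -> {mpoly R[n]}) (p_in : 'I_mi -> {mpoly R[n]}) :
  (exists u, in_Kc f ceq cin u) ->
  assumptionA f ceq cin p_eq p_in ->
  (forall fc : \bar R, is_einf (fc_vals f ceq cin p_eq p_in) fc ->
     exists k0 : nat, forall k : nat, (k0 <= k)%N ->
       is_esup (sos_vals f ceq cin p_eq p_in k) fc /\
       is_einf (mom_vals f ceq cin p_eq p_in k) fc) /\
  (forall u : 'I_n -> R,
     feasible ceq cin u -> in_Kc f ceq cin u ->
     (forall x, feasible ceq cin x -> f.@[u] <= f.@[x]) ->
     exists k0 : nat, forall k : nat, (k0 <= k)%N ->
       is_esup (sos_vals f ceq cin p_eq p_in k) (f.@[u])%:E /\
       is_einf (mom_vals f ceq cin p_eq p_in k) (f.@[u])%:E).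
Proof.
move=> _ hA; split; first exact: tight_relaxation.
move=> u feas [lam_eq [lam_in crit]] umin; apply: tight_relaxation.
have [a1 a2] := hA _ _ _ crit; have [c1 [c2 c3]] := crit.
(* At [u] the p_i take the values of the true multipliers, so phi vanishes by criticality and psi is
   nonnegative by optimality; the infimum of the tightened problem is then f(u). *)
have Su : feasible_c f ceq cin p_eq p_in u.
  split=> //; split=> q; last first.
    by move=> /mapP[j _ ->]; rewrite -a2; apply: multiplier_nneg hA crit feas umin j.
  rewrite mem_cat => /orP[/mapP[l _ ->]|/mapP[j _ ->]]; last by rewrite mevalM -a2 c2.
  rewrite !mevalB c3 !rmorph_sum -addrA -opprD.
  apply/eqP; rewrite subr_eq0; apply/eqP; congr (_ + _); apply: eq_bigr => i _.
    by rewrite rmorphM /= -a1.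
  by rewrite rmorphM /= -a2.
split=> [_ [x [[fx _] ->]]|w hw]; first by rewrite lee_fin; apply: umin.
by apply: hw; exists u.
Qed.
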